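(* Let $K$ be a non-archimedean local field, $r\ge1$ an integer, and for each $n$ let $G_n=\langle g_{1_n},\dots,g_{r_n}\rangle$ be a discrete non-elementary subgroup of $\mathrm{SL}_2(K)$. Suppose $\{G_n\}$ converges algebraically to $G=\langle g_1,\dots,g_r\rangle\le\mathrm{SL}_2(K)$, in the sense that for every word $w$ in the free group $F_r$ on $r$ letters, $w(g_{1_n},\dots,g_{r_n})$ converges in $\mathrm{SL}_2(K)$, with $g_i=\lim_n g_{i_n}$ and $G$ the set of these limits. Then $G$ is discrete and non-elementary, and for all sufficiently large $n$ the assignment $g_i\mapsto g_{i_n}$ ($i=1,\dots,r$) extends to a surjective homomorphism $\psi_n:G\to G_n$.
   Context: A non-archimedean local field is a finite extension of $\mathbb{Q}_p$ or $\mathbb{F}_q((t))$. $\mathrm{SL}_2(K)$ has the subspace topology from $K^4$ and acts by isometries on its Bruhat–Tits tree $T_K$. A subgroup is elementary if it stabilises a vertex, an end, or a pair of ends of $T_K$, and non-elementary otherwise. *)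

(* Defs.v *)
From HB Require Import structures.
From mathcomp Require Import all_boot all_order all_algebra.
Set Implicit Arguments. Unset Strict Implicit. Unset Printing Implicit Defensive.
Import Order.TTheory GRing.Theory Num.Theory.
Local Open Scope ring_scope.

(* ---------- Non-archimedean local fields via a normalized discrete valuation ----------
   v : K -> int is the valuation; its value at 0 is irrelevant (never used:
   "close" below treats x = y separately). *)

Definition close (K : fieldType) (v : K -> int) (N : int) (x y : K) : Prop :=
  x = y \/ N <= v (x - y).

Definition cvgK (K : fieldType) (v : K -> int) (u : nat -> K) (x : K) : Prop :=
  forall N : int, exists M : nat, forall n, (M <= n)%N -> close v N (u n) x.

Definition cauchyK (K : fieldType) (v : K -> int) (u : nat -> K) : Prop :=
  forall N : int, exists M : nat, forall m n, (M <= m)%N -> (M <= n)%N ->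
    close v N (u m) (u n).

Definition intO (K : fieldType) (v : K -> int) (x : K) : Prop := x = 0 \/ 0 <= v x.

Definition nonarch_local_field (K : fieldType) (v : K -> int) : Prop :=
  [/\ forall x y : K, x != 0 -> y != 0 -> v (x * y) = v x + v y,
      forall x y : K, x != 0 -> y != 0 -> x + y != 0 ->
        Num.min (v x) (v y) <= v (x + y),
      exists pi : K, pi != 0 /\ v pi = 1,
      forall u : nat -> K, cauchyK v u -> exists x, cvgK v u x
    & exists s : seq K, (forall y, y \in s -> intO v y) /\
        (forall x, intO v x -> exists2 y, y \in s & close v 1 x y)].

Definition SL2 (K : fieldType) (A : 'M[K]_2) : Prop := \det A = 1.

Definition mcvg (K : fieldType) (v : K -> int) (u : nat -> 'M[K]_2) (A : 'M[K]_2)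
  : Prop := forall i j, cvgK v (fun n => u n i j) (A i j).

Definition discrete (K : fieldType) (v : K -> int) (G : 'M[K]_2 -> Prop) : Prop :=
  forall h, G h -> exists N : int, forall g, G g ->
    (forall i j, close v N (g i j) (h i j)) -> g = h.

(* the O-lattice in K^2 spanned by the columns of A (A invertible) *)
Definition lat (K : fieldType) (v : K -> int) (A : 'M[K]_2) : 'cV[K]_2 -> Prop :=
  fun x => exists c : 'cV[K]_2, (forall i, intO v (c i 0)) /\ x = A *m c.

Definition set_eqP (T : Type) (P Q : T -> Prop) := forall x, P x <-> Q x.
Definition set_subP (T : Type) (P Q : T -> Prop) := forall x, P x -> Q x.
Definition set_psubP (T : Type) (P Q : T -> Prop) := set_subP P Q /\ ~ set_eqP P Q.

(* same vertex: homothetic lattices *)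
Definition homothetic (K : fieldType) (v : K -> int) (A B : 'M[K]_2) : Prop :=
  exists c : K, c != 0 /\ set_eqP (lat v (c *: A)) (lat v B).

Definition adjacent (K : fieldType) (v : K -> int) (A B : 'M[K]_2) : Prop :=
  exists pi c : K, [/\ pi != 0, v pi = 1, c != 0,
    set_psubP (lat v (pi *: A)) (lat v (c *: B)) & set_psubP (lat v (c *: B)) (lat v A)].

Definition ray (K : fieldType) (v : K -> int) (r : nat -> 'M[K]_2) : Prop :=
  forall k, [/\ r k \in unitmx, adjacent v (r k) (r k.+1) & ~ homothetic v (r k) (r k.+2)].

(* rays define the same end iff they share a common subray *)
Definition ray_equiv (K : fieldType) (v : K -> int) (r1 r2 : nat -> 'M[K]_2) : Prop :=
  exists k l : nat, forall m, homothetic v (r1 (k + m)%N) (r2 (l + m)%N).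

Definition act_ray (K : fieldType) (g : 'M[K]_2) (r : nat -> 'M[K]_2) :=
  fun k => g *m r k.

Definition stab_vertex (K : fieldType) (v : K -> int) (G : 'M[K]_2 -> Prop) : Prop :=
  exists A, A \in unitmx /\ forall g, G g -> homothetic v (g *m A) A.

Definition stab_end (K : fieldType) (v : K -> int) (G : 'M[K]_2 -> Prop) : Prop :=
  exists r, ray v r /\ forall g, G g -> ray_equiv v (act_ray g r) r.

Definition stab_pair_ends (K : fieldType) (v : K -> int) (G : 'M[K]_2 -> Prop) : Prop :=
  exists r1 r2, [/\ ray v r1, ray v r2, ~ ray_equiv v r1 r2 &
    forall g, G g ->
      (ray_equiv v (act_ray g r1) r1 /\ ray_equiv v (act_ray g r2) r2) \/
      (ray_equiv v (act_ray g r1) r2 /\ ray_equiv v (act_ray g r2) r1)].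

Definition elementary (K : fieldType) (v : K -> int) (G : 'M[K]_2 -> Prop) : Prop :=
  stab_vertex v G \/ stab_end v G \/ stab_pair_ends v G.

(* a word: a sequence of letters x_i^{+1} (false) or x_i^{-1} (true) *)
Definition word (r : nat) := seq ('I_r * bool).

Definition letter (K : fieldType) (r : nat) (g : 'I_r -> 'M[K]_2) (l : 'I_r * bool) :=
  if l.2 then invmx (g l.1) else g l.1.

Definition eval_word (K : fieldType) (r : nat) (g : 'I_r -> 'M[K]_2) (w : word r)
  : 'M[K]_2 := foldr (fun l acc => letter g l *m acc) 1%:M w.

Definition gen (K : fieldType) (r : nat) (g : 'I_r -> 'M[K]_2) : 'M[K]_2 -> Prop :=
  fun h => exists w : word r, h = eval_word g w.

(* Main.v *)
Require Import Defs.
From mathcomp Require Import all_boot all_order all_algebra.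
From mathcomp Require Import zify ring.
From Stdlib Require Import Classical ClassicalEpsilon.
Set Implicit Arguments. Unset Strict Implicit. Unset Printing Implicit Defensive.
Import Order.TTheory GRing.Theory Num.Theory.
Local Open Scope ring_scope.

(** Discreteness is uniform: if the generators stay bounded, a discrete non-elementary
    group meets a fixed neighbourhood U of 1 trivially. Hence G meets U trivially, and
    two words that agree in G agree in G_n for large n.

    To make this uniform in the word, let T be the finite set of elements of G moving the
    base vertex at most as far as the generators do. A relation of G is a closed path in
    the orbit of the base vertex; as the tree is 0-hyperbolic, its farthest point can be
    skipped by multiplying two elements of T inside T. So all relations follow from the
    finitely many relations t t' = t'' in T.

    If G fixed a vertex, so would G_n, since being in a conjugate of SL_2(O) is an open
    condition on the generators. If G fixed an end or a pair of ends but no vertex, it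
    would contain a hyperbolic element h commuting with its conjugates by the generators
    (for an end, discreteness makes G diagonal). These finitely many relations pass to
    G_n, which then preserves the axis of the hyperbolic element h_n. *)

(** A relation of G holds in G_n from some n on, but that n depends on the relation, and nothing
    says beforehand that finitely many relations suffice. One fixed T works because 0-hyperbolicity
    carries no error term: the step that skips a point obeys the same bound as the two steps it
    replaces, so it stays in T. The tree is handled through matrices: vertices are invertible
    matrices up to scalars and GL_2(O), displacements are norms, the four-point inequality is the
    ultrametric reading of a Plucker identity, and ends are lines of K^2. The axis of h_n is never
    compared with that of h: what is carried from G to G_n is a trace of negative valuation together
    with commutation relations, and these alone force the generators of G_n to permute the two
    eigenlines of h_n. *)

Lemma ord2P (P : 'I_2 -> Prop) : P 0 -> P 1 -> forall i, P i.
Proof.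
move=> P0 P1 [[|[|n]] lti] //.
- by rewrite (_ : Ordinal lti = 0) //; apply: val_inj.
- by rewrite (_ : Ordinal lti = 1) //; apply: val_inj.
Qed.

Lemma sum2 (V : nmodType) (F : 'I_2 -> V) : \sum_i F i = F 0 + F 1.
Proof. by rewrite !big_ord_recl big_ord0 addr0; congr (_ + F _); apply: val_inj. Qed.

(** An element may have several codes, but a code belongs to at most one element. The induction on
    [s] asks classically whether the first code is used, since [P] and [R] are arbitrary
    propositions. *)
Lemma finite_of_code (T U : eqType) (P : T -> Prop) (R : T -> U -> Prop)
    (s : seq U) :
  (forall t, P t -> exists2 y, y \in s & R t y) ->
  (forall t t' y, R t y -> R t' y -> t = t') ->
  exists l : seq T, forall t, P t -> t \in l.
Proof.
move=> sP Rinj; have {sP} : forall t, P t -> exists2 y, y \in s & R t y := sP.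
elim: s P => [|y s IHs] P sP; first by exists [::] => t /sP [].
have [l lP] : exists l : seq T, forall t, P t /\ ~ R t y -> t \in l.
  apply: IHs => t [/sP [z]]; rewrite inE => /orP [/eqP -> //|zs Rz _].
  by exists z.
have [[t0 Rt0]|noR] := classic (exists t, R t y).
  exists (t0 :: l) => t Pt; rewrite inE; apply/orP.
  have [Rt|nRt] := classic (R t y); first by left; apply/eqP/(Rinj t t0 y).
  by right; apply: lP.
by exists l => t Pt; apply: lP; split=> // Rt; apply: noR; exists t.
Qed.

(** * Two by two matrices in coordinates *)

Definition mx2 (K : nzRingType) (a b c d : K) : 'M[K]_2 :=
  \matrix_(i, j) if i == 0 then (if j == 0 then a else b)
                 else (if j == 0 then c else d).

Section Matrix2.
Variable K : fieldType.
Implicit Types (A B : 'M[K]_2) (a b c d : K).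

Lemma mx2E a b c d : (mx2 a b c d 0 0 = a) * (mx2 a b c d 0 1 = b)
  * (mx2 a b c d 1 0 = c) * (mx2 a b c d 1 1 = d).
Proof. by rewrite !mxE. Qed.

Lemma mx2_eta A : A = mx2 (A 0 0) (A 0 1) (A 1 0) (A 1 1).
Proof. by apply/matrixP; apply: ord2P; apply: ord2P; rewrite mx2E. Qed.

Lemma mx2P A B : A 0 0 = B 0 0 -> A 0 1 = B 0 1 -> A 1 0 = B 1 0 ->
  A 1 1 = B 1 1 -> A = B.
Proof. by move=> ????; apply/matrixP; apply: ord2P; apply: ord2P. Qed.

Lemma mulmx2 n m (A : 'M[K]_(m, 2)) (B : 'M_(2, n)) i j :
  (A *m B) i j = A i 0 * B 0 j + A i 1 * B 1 j.
Proof. by rewrite mxE sum2. Qed.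

Lemma det2 A : \det A = A 0 0 * A 1 1 - A 0 1 * A 1 0.
Proof.
rewrite (expand_det_row _ 0) sum2 /cofactor !det_mx11 !mxE /= expr0 expr1.
rewrite !mul1r mulN1r mulrN.
by congr (_ * A _ _ - _ * A _ _); apply: val_inj.
Qed.

Lemma det_mx2 a b c d : \det (mx2 a b c d) = a * d - b * c.
Proof. by rewrite det2 !mx2E. Qed.

Lemma tr2 A : \tr A = A 0 0 + A 1 1.
Proof. by rewrite /mxtrace sum2. Qed.

(** On SL_2 this is the inverse, and its entries are those of [A] up to order and sign; hence
    inversion preserves norms and limits. *)
Definition adj2 A := mx2 (A 1 1) (- A 0 1) (- A 1 0) (A 0 0).

Lemma mul_adj2 A : A *m adj2 A = (\det A)%:M.
Proof. by apply: mx2P; rewrite mulmx2 !mxE det2 /=; ring. Qed.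

Lemma invmx2 A : A \in unitmx -> invmx A = (\det A)^-1 *: adj2 A.
Proof.
move=> Au; rewrite -[RHS]mul1mx -(mulVmx Au) -mulmxA -scalemxAr mul_adj2.
rewrite scale_scalar_mx mulVf ?mulmx1 //.
by move: Au; rewrite unitmxE unitfE.
Qed.

Lemma unitmx_det A : (A \in unitmx) = (\det A != 0).
Proof. by rewrite unitmxE unitfE. Qed.

Lemma SL2_unit A : SL2 A -> A \in unitmx.
Proof. by rewrite /SL2 unitmx_det => ->; rewrite oner_eq0. Qed.

Lemma SL2_inv A : SL2 A -> invmx A = adj2 A.
Proof. by move=> A1; rewrite invmx2 ?SL2_unit // A1 invr1 scale1r. Qed.

Lemma SL2_mul A B : SL2 A -> SL2 B -> SL2 (A *m B).
Proof. by rewrite /SL2 det_mulmx => -> ->; rewrite mulr1. Qed.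

Lemma SL2_invmx A : SL2 A -> SL2 (invmx A).
Proof. by rewrite /SL2 det_inv => ->; rewrite invr1. Qed.

Lemma SL2_1 : SL2 (1%:M : 'M[K]_2).
Proof. by rewrite /SL2 det1. Qed.

Lemma Cayley_Hamilton2 A : A *m A = \tr A *: A - (\det A)%:M.
Proof. by apply: mx2P; rewrite !(mulmx2, mxE) det2 tr2 /=; ring. Qed.

End Matrix2.

(** * Ultrametric estimates in the field *)

Section Valuation.
Variables (K : fieldType) (v : K -> int).
Hypothesis Kv : nonarch_local_field v.
Implicit Types (x y z : K) (A B C : 'M[K]_2).

(** The fractional ideal pi^N O; zero is set apart because [v 0] is an arbitrary value. *)
Definition vge N x := x = 0 \/ N <= v x.

Lemma vM x y : x != 0 -> y != 0 -> v (x * y) = v x + v y.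
Proof. by case: Kv => H _ _ _ _; apply: H. Qed.

Lemma v1 : v 1 = 0.
Proof. have := @vM 1 1 (oner_neq0 _) (oner_neq0 _); rewrite mulr1. move: (v 1) => a; lia. Qed.

Lemma vN x : v (- x) = v x.
Proof.
have [->|x0] := eqVneq x 0; first by rewrite oppr0.
have n10 : (-1 : K) != 0 by rewrite oppr_eq0 oner_neq0.
have := @vM (-1) (-1) n10 n10.
rewrite mulrNN mulr1 v1 -[- x]mulN1r vM //; lia.
Qed.

Lemma vV x : x != 0 -> v x^-1 = - v x.
Proof.
move=> x0; have x'0 : x^-1 != 0 by rewrite invr_eq0.
have := vM x0 x'0; rewrite mulfV // v1; lia.
Qed.

Lemma vX x n : x != 0 -> v (x ^+ n) = v x *+ n.
Proof.
move=> x0; elim: n => [|n IHn]; first by rewrite expr0 v1.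
by rewrite exprS vM ?expf_neq0 // IHn mulrS.
Qed.

Lemma vge0 N : vge N 0. Proof. by left. Qed.
Hint Resolve vge0 : core.

Lemma vgeN N x : vge N x -> vge N (- x).
Proof. by case=> [->|]; [left; rewrite oppr0 | right; rewrite vN]. Qed.

Lemma vgeD N x y : vge N x -> vge N y -> vge N (x + y).
Proof.
case=> [->|Nx]; first by rewrite add0r.
case=> [->|Ny]; first by rewrite addr0; right.
have [->|x0] := eqVneq x 0; first by rewrite add0r; right.
have [->|y0] := eqVneq y 0; first by rewrite addr0; right.
have [->|xy0] := eqVneq (x + y) 0; first by left.
right; case: Kv => _ H _ _ _; have := H x y x0 y0 xy0; lia.
Qed.

Lemma vgeB N x y : vge N x -> vge N y -> vge N (x - y).
Proof. by move=> Nx Ny; apply: vgeD => //; apply: vgeN. Qed.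

Lemma vgeM N M x y : vge N x -> vge M y -> vge (N + M) (x * y).
Proof.
have [->|x0] := eqVneq x 0; first by rewrite mul0r.
have [->|y0] := eqVneq y 0; first by rewrite mulr0.
case=> [x0'|Nx]; first by rewrite x0' eqxx in x0.
case=> [y0'|My]; first by rewrite y0' eqxx in y0.
by right; rewrite vM // lerD.
Qed.

Lemma vgeW N M x : M <= N -> vge N x -> vge M x.
Proof. by move=> MN [->|Nx]; [left | right; apply: le_trans Nx]. Qed.

Lemma vge_refl x : vge (v x) x.
Proof. by right. Qed.

Lemma vgeE N x : x != 0 -> vge N x -> N <= v x.
Proof. by move=> x0 [x0'|//]; rewrite x0' eqxx in x0. Qed.

Lemma vge1 : vge 0 1.
Proof. by right; rewrite v1. Qed.

Lemma vge_M0l N x y : vge 0 x -> vge N y -> vge N (x * y).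
Proof. by move=> x0 Ny; have := vgeM x0 Ny; rewrite add0r. Qed.

Lemma vge_M0r N x y : vge N x -> vge 0 y -> vge N (x * y).
Proof. by move=> x0 Ny; have := vgeM x0 Ny; rewrite addr0. Qed.

Lemma vge_nat n : vge 0 n%:R.
Proof. elim: n => [|n IHn] //; rewrite -natr1; apply: vgeD => //; exact: vge1. Qed.

Lemma vge_all x : (forall N, vge N x) -> x = 0.
Proof. by move=> /(_ (v x + 1)) [//|]; lia. Qed.

Lemma vgeX n x : vge 1 x -> vge n%:Z (x ^+ n).
Proof.
move=> x1; elim: n => [|n IHn]; first by rewrite expr0; exact: vge1.
by rewrite exprS; have := vgeM x1 IHn; apply: vgeW; lia.
Qed.

Lemma vge_divl N x y : x != 0 -> vge N (x * y) -> vge (N - v x) y.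
Proof.
move=> x0 [/eqP|Nxy]; first by rewrite mulf_eq0 (negPf x0) /= => /eqP ->.
have [->|y0] := eqVneq y 0; first by [].
by right; move: Nxy; rewrite vM //; lia.
Qed.

Lemma v_close x y : x != 0 -> vge (v x + 1) (y - x) -> y != 0 /\ v y = v x.
Proof.
move=> x0 yx.
have y0 : y != 0.
  apply/eqP => y0; move: yx; rewrite y0 sub0r => /vgeN; rewrite opprK.
  by move/(vgeE x0); lia.
split=> //; apply/eqP; rewrite eq_le; apply/andP; split; last first.
  apply: vgeE => //; rewrite -[y](subrK x); apply: vgeD; last exact: vge_refl.
  by apply: vgeW yx; lia.
rewrite leNgt; apply/negP => lt_v.
have: vge (v x + 1) (y - (y - x)).
  by apply: vgeB => //; right; lia.
by rewrite subKr => /(vgeE x0); lia.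
Qed.

Lemma closeE N x y : close v N x y <-> vge N (x - y).
Proof.
split=> [[->|]|[/eqP|]]; rewrite ?subrr; rewrite ?subr_eq0; [by left|by right| |by right].
by move/eqP; left.
Qed.

Lemma intOE x : intO v x <-> vge 0 x.
Proof. by []. Qed.

(** Every difference after step [k] lies in pi^k O, hence so does every sum of them; the limit
    inherits this bound. *)
Lemma series_cvg (u : nat -> K) : (forall k, vge k%:Z (u k.+1 - u k)) ->
  exists x, forall k, vge k%:Z (x - u k).
Proof.
move=> du.
have du2 k m : vge k%:Z (u (k + m)%N - u k).
  elim: m => [|m IHm]; first by rewrite addn0 subrr.
  rewrite addnS -(subrKA (u (k + m)%N)); apply: vgeD => //.
  by apply: vgeW (du _); lia.
have duN k m : (k <= m)%N -> vge k%:Z (u m - u k).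
  by move=> km; rewrite -(subnKC km).
case: Kv => _ _ _ /(_ u) cpl _.
have [|x xP] := cpl.
  move=> N; exists `|N|%N => m n Nm Nn; apply/closeE.
  rewrite -(subrKA (u `|N|%N)) -[_ - u n]opprB.
  by apply: vgeB; apply: vgeW (duN _ _ _) => //; lia.
exists x => k; have [M MP] := xP k%:Z.
rewrite -(subrKA (u (M + k)%N)) -[x - _]opprB; apply: vgeD; last first.
  by apply: duN; lia.
by apply: vgeN; apply/closeE; apply: MP; lia.
Qed.

Lemma uniformizer : exists pi, pi != 0 /\ v pi = 1.
Proof. by case: Kv. Qed.

(* substituting x = t m turns the equation into m = t^-2 + m^2, a contraction of pi O *)
Lemma quadratic_root t : t != 0 -> v t < 0 -> exists x, x ^+ 2 - t * x + 1 = 0.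
Proof.
move=> t0 vt; pose s := t^-1 ^+ 2.
have s1 : vge 1 s by right; rewrite vX ?invr_eq0 // vV //; lia.
pose u k := iter k (fun m => s + m ^+ 2) 0.
have uS k : u k.+1 = s + u k ^+ 2 by [].
have u1 k : vge 1 (u k).
  elim: k => [//|k IHk]; rewrite uS; apply: vgeD => //; rewrite expr2.
  by apply: vgeW (vgeM IHk IHk); lia.
have du k : vge k%:Z (u k.+1 - u k).
  elim: k => [|k IHk]; first by rewrite uS subr0 expr0n addr0; apply: vgeW s1.
  have -> : u k.+2 - u k.+1 = (u k.+1 - u k) * (u k.+1 + u k).
    by rewrite (uS k.+1) {2}(uS k); ring.
  by apply: vgeW (vgeM IHk (vgeD (u1 _) (u1 _))); lia.
have [m mP] := series_cvg du.
have mE : m = s + m ^+ 2.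
  apply/eqP; rewrite -subr_eq0; apply/eqP; apply: vge_all => N.
  apply: (@vgeW `|N|%N%:Z); first lia.
  set k := `|N|%N.
  have -> : m - (s + m ^+ 2) = (m - u k.+1) - (m - u k) * (m - u k + u k *+ 2).
    by rewrite uS; ring.
  have mk : vge 0 (m - u k) by apply: vgeW (mP _).
  apply: vgeB; first by apply: vgeW (mP _); lia.
  apply: vge_M0r => //; apply: vgeD => //; rewrite mulr2n.
  by apply: vgeD; apply: vgeW (u1 _).
exists (t * m); rewrite /s in mE.
have -> : (t * m) ^+ 2 - t * (t * m) + 1 = t ^+ 2 * (t^-1 ^+ 2 + m ^+ 2 - m) by field.
by rewrite -mE subrr mulr0.
Qed.

(** Representatives are built digit by digit: [pi ^+ n * z], with [z] representing a residue class,
    corrects a representative modulo pi^n. *)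
Lemma finite_quotient n : exists s : seq K, forall x, vge 0 x ->
  exists2 y, y \in s & vge n%:Z (x - y).
Proof.
have [pi [pi0 vpi]] := uniformizer.
case: Kv => _ _ _ _ [s [sO sP]].
elim: n => [|n [t tP]].
  by exists [:: 0] => x x0; exists 0; rewrite ?subr0 // mem_seq1.
exists [seq y + pi ^+ n * z | y <- t, z <- s] => x x0.
have [y yt xy] := tP x x0.
have [|z zs xz] := sP ((x - y) / pi ^+ n).
  apply/intOE; apply: (@vgeW (n%:Z - n%:Z)); first lia.
  have := @vge_divl n%:Z (pi ^+ n) ((x - y) / pi ^+ n).
  rewrite mulrC divfK ?expf_neq0 // vX // vpi => H.
  by apply: vgeW (H isT xy); lia.
exists (y + pi ^+ n * z); first exact: allpairs_f.
have -> : x - (y + pi ^+ n * z) = pi ^+ n * ((x - y) / pi ^+ n - z).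
  by field; rewrite expf_neq0.
have pin : vge n%:Z (pi ^+ n) by apply: vgeX; right; rewrite vpi.
by move/closeE: xz => xz; apply: vgeW (vgeM pin xz); lia.
Qed.

(** Two natural numbers agree modulo pi, for otherwise the finitely many residue classes would code
    all of them; [q] is their difference. It is a multiple of the residue characteristic, not
    necessarily prime. *)
Lemma residue_nat : exists2 q : nat, (0 < q)%N & vge 1 (q%:R : K).
Proof.
have [s sP] := finite_quotient 1.
apply: NNPP => noq.
have [//|m n y /= ym yn|l lP] := finite_of_code (P := fun _ : nat => True)
    (R := fun n y => vge 1 (n%:R - y)) (s := s).
- by move=> n _; apply/sP/vge_nat.
- wlog lt_mn : m n ym yn / (m < n)%N.
    by move=> W; case: (ltngtP m n) => // /W -> //.
  case: noq; exists (n - m)%N; first by rewrite subn_gt0.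
  rewrite natrB 1?ltnW // -(subrKA y) -[y - _]opprB.
  exact: vgeB.
- have := lP (\max_(i <- l) i).+1 I; rewrite -index_mem => lt_i.
  have := @leq_bigmax_seq _ l xpredT id (\max_(i <- l) i).+1.
  by rewrite -index_mem lt_i ltnn => /(_ isT isT).
Qed.


(** * Entrywise bounds for matrices *)

Definition mge N m n (A : 'M[K]_(m, n)) := forall i j, vge N (A i j).

Lemma mgeW N M m n (A : 'M[K]_(m, n)) : M <= N -> mge N A -> mge M A.
Proof. by move=> MN NA i j; apply: vgeW (NA i j). Qed.

Lemma mgeD N m n (A B : 'M[K]_(m, n)) : mge N A -> mge N B -> mge N (A + B).
Proof. by move=> NA NB i j; rewrite mxE; apply: vgeD. Qed.

Lemma mgeN N m n (A : 'M[K]_(m, n)) : mge N A -> mge N (- A).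
Proof. by move=> NA i j; rewrite mxE; apply: vgeN. Qed.

Lemma mgeM N M m n (A : 'M[K]_(m, 2)) (B : 'M[K]_(2, n)) :
  mge N A -> mge M B -> mge (N + M) (A *m B).
Proof. by move=> NA NB i j; rewrite mulmx2; apply: vgeD; apply: vgeM. Qed.

Lemma mge_mul0 m n (A : 'M[K]_(m, 2)) (B : 'M[K]_(2, n)) :
  mge 0 A -> mge 0 B -> mge 0 (A *m B).
Proof. by move=> A0 B0; apply: (mgeM A0 B0). Qed.

Lemma mgeZ N M m n c (A : 'M[K]_(m, n)) :
  vge N c -> mge M A -> mge (N + M) (c *: A).
Proof. by move=> Nc NA i j; rewrite mxE; apply: vgeM. Qed.

Lemma mge0 N m n : mge N (0 : 'M[K]_(m, n)).
Proof. by move=> i j; rewrite mxE. Qed.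

Lemma mge_mx2 N a b c d : vge N a -> vge N b -> vge N c -> vge N d ->
  mge N (mx2 a b c d).
Proof. by move=> ????; apply: ord2P; apply: ord2P; rewrite mx2E. Qed.

Lemma mge_scalar N c : vge N c -> mge N (c%:M : 'M[K]_2).
Proof. by move=> Nc; apply: ord2P; apply: ord2P; rewrite !mxE. Qed.

Lemma mge1 : mge 0 (1%:M : 'M[K]_2).
Proof. exact/mge_scalar/vge1. Qed.

Lemma mge_adj2 N A : mge N A -> mge N (adj2 A).
Proof. by move=> NA; apply: mge_mx2 => //; apply: vgeN. Qed.

Lemma mge_det A : mge 0 A -> vge 0 (\det A).
Proof. by move=> A0; rewrite det2; apply: vgeB; apply: vge_M0l. Qed.

Lemma mge_all m n (A : 'M[K]_(m, n)) : (forall N, mge N A) -> A = 0.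
Proof. by move=> allA; apply/matrixP => i j; rewrite mxE; apply: vge_all => N; apply: allA. Qed.

Lemma mge_bound m n (A : 'M[K]_(m, n)) : exists c : nat, mge (- c%:Z) A.
Proof.
exists (\max_i \max_j `|v (A i j)|)%N => i j; right.
have /= := leq_bigmax (F := fun i => \max_j `|v (A i j)|)%N i.
have /= := leq_bigmax (F := fun j => `|v (A i j)|)%N j.
lia.
Qed.

Lemma mge_conj N c A B : SL2 B -> mge (- c) B -> mge (N + c *+ 2) A ->
  mge N (B *m A *m invmx B).
Proof.
move=> B1 cB NA; rewrite SL2_inv //.
by apply: mgeW (mgeM (mgeM cB NA) (mge_adj2 cB)); lia.
Qed.

Lemma mge_near1 A : mge 0 (A - 1%:M) -> mge 0 A.
Proof. by move=> A1; rewrite -[A](subrK 1%:M); apply: mgeD => //; exact: mge1. Qed.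

Lemma mge_mul_near1 N A B : 0 <= N -> mge N (A - 1%:M) -> mge N (B - 1%:M) ->
  mge N (A *m B - 1%:M).
Proof.
move=> N0 NA NB.
have -> : A *m B - 1%:M = A *m (B - 1%:M) + (A - 1%:M).
  by rewrite mulmxBr mulmx1 addrA subrK.
apply: mgeD => //; rewrite -[N]add0r; apply: mgeM => //.
by apply: mge_near1; apply: mgeW NA.
Qed.

(** * Powers of matrices close to the identity *)

Section Powers.
Variable q : nat.
Hypothesis q1 : vge 1 (q%:R : K).

Lemma mge_expr_near1 N A k : 0 <= N -> mge N (A - 1) -> mge N (A ^+ k - 1).
Proof.
move=> N0 NA; elim: k => [|k IHk]; first by rewrite expr0 subrr; apply: mge0.
by rewrite exprS; apply: mge_mul_near1.
Qed.

Lemma sum_expr_near1 A : \sum_(i < q) A ^+ i = (q%:R)%:M + \sum_(i < q) (A ^+ i - 1).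
Proof.
rewrite -scalemx1 scaler_nat -[X in _ *+ X]card_ord -sumr_const -big_split /=.
by apply: eq_bigr => i _; rewrite addrC subrK.
Qed.

Lemma mge_sum_expr_near1 N A : 0 <= N -> mge N (A - 1) ->
  mge N (\sum_(i < q) (A ^+ i - 1)).
Proof.
move=> N0 NA; elim/big_ind: _ => [|B C|i _]; first exact: mge0.
  exact: mgeD.
exact: mge_expr_near1.
Qed.

(** In A^q - 1 = (A - 1)(1 + A + ... + A^(q-1)) the second factor is congruent to q, hence to 0,
    modulo pi; so each q-th power gains one digit. *)
Lemma mge_exprq N A : 1 <= N -> mge N (A - 1) -> mge (N + 1) (A ^+ q - 1).
Proof.
move=> N1 NA; rewrite subrX1; apply: mgeM => //; rewrite sum_expr_near1.
apply: mgeD; first exact: mge_scalar.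
by apply: mgeW (mge_sum_expr_near1 _ NA) => //; lia.
Qed.

Lemma mge_exprqk A k : mge 1 (A - 1) -> mge (k%:Z + 1) (A ^+ (q ^ k) - 1).
Proof.
move=> A1; elim: k => [|k IHk]; first by rewrite expn0 expr1.
by rewrite expnSr exprM; apply: mgeW (mge_exprq _ IHk); lia.
Qed.

(** With X = A - 1, the equation A^q = 1 reads qX = -XS. The threshold [v q%:R + 1] makes S strictly
    smaller than q, so X is divisible by ever higher powers of pi. *)
Lemma small_torsion_trivial A : q%:R != 0 :> K ->
  mge (v q%:R + 1) (A - 1) -> A ^+ q = 1 -> A = 1.
Proof.
move=> q0 smallA Aq; apply/eqP; rewrite -subr_eq0; apply/eqP.
have vq := vgeE q0 q1.
set X := A - 1; set S := \sum_(i < q) (A ^+ i - 1).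
have SN : mge (v q%:R + 1) S by apply: mge_sum_expr_near1 smallA; lia.
have qX : q%:R *: X = - (X *m S).
  apply/eqP; rewrite -addr_eq0 -mul_mx_scalar -mulmxDr -sum_expr_near1.
  by rewrite -[_ *m _]/(X * _) -subrX1 Aq subrr.
have step N : mge N X -> mge (N + 1) X.
  move=> NX i j; have := mgeN (mgeM NX SN) i j; rewrite -qX mxE => H.
  by apply: vgeW (vge_divl q0 H); lia.
have stepk (k : nat) : mge k%:Z X.
  elim: k => [|k /step IHk]; first by apply: mgeW smallA; lia.
  by apply: mgeW IHk; lia.
by apply: mge_all => N; apply: mgeW (stepk `|N|%N); lia.
Qed.

Lemma small_torsion_trivial_pow A k : q%:R != 0 :> K ->
  mge (v q%:R + 1) (A - 1) -> A ^+ (q ^ k) = 1 -> A = 1.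
Proof.
move=> q0 smallA; elim: k => [|k IHk]; first by rewrite expn0 expr1.
rewrite expnSr exprM => /(small_torsion_trivial q0) H; apply: IHk; apply: H.
by apply: mge_expr_near1 => //; have := vgeE q0 q1; lia.
Qed.

End Powers.

(** * Nilpotent matrices and the lines they determine *)

(** Once the determinant vanishes, Cayley-Hamilton gives A^(k+1) = (tr A)^k A. *)
Lemma nilpotent_mx2 A n : A ^+ n = 0 -> \tr A = 0 /\ \det A = 0.
Proof.
case: n => [/eqP|n An]; first by rewrite expr0 oner_eq0.
have detA : \det A = 0.
  have detX m : \det (A ^+ m) = (\det A) ^+ m.
    by elim: m => [|m IHm]; rewrite ?det1 // !exprS -IHm -det_mulmx.
  by have /eqP := detX n.+1; rewrite An det0 eq_sym expf_eq0 => /eqP.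
split=> //.
have AS k : A ^+ k.+1 = (\tr A) ^+ k *: A.
  elim: k => [|k IHk]; first by rewrite expr1 expr0 scale1r.
  rewrite exprSr IHk -scalerAl [A * A]Cayley_Hamilton2 detA raddf0 subr0.
  by rewrite scalerA -exprSr.
move: An; rewrite AS => /eqP; rewrite scaler_eq0 => /orP [|/eqP ->].
  by rewrite expf_eq0 => /andP [_ /eqP].
by rewrite linear0.
Qed.

(* the SL_2-invariant symplectic form *)
Definition om (x y : 'cV[K]_2) : K := x 0 0 * y 1 0 - x 1 0 * y 0 0.

Definition collinear (x y : 'cV[K]_2) : Prop := exists a, x = a *: y.

Lemma cV2P (x y : 'cV[K]_2) : x 0 0 = y 0 0 -> x 1 0 = y 1 0 -> x = y.
Proof. by move=> ??; apply/matrixP; apply: ord2P => j; rewrite ord1. Qed.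

Lemma om_collinear (x y : 'cV[K]_2) : y != 0 -> om x y = 0 -> collinear x y.
Proof.
move=> y0; rewrite /om => /eqP; rewrite subr_eq0 => /eqP xy.
have [y00|y00] := eqVneq (y 0 0) 0.
  have y10 : y 1 0 != 0.
    by apply: contraNneq y0 => y10; apply/eqP/cV2P; rewrite !mxE.
  exists (x 1 0 / y 1 0); apply: cV2P; rewrite !mxE ?divfK // y00 mulr0.
  by apply/eqP; move/eqP: xy; rewrite y00 mulr0 mulf_eq0 (negPf y10) orbF.
exists (x 0 0 / y 0 0); apply: cV2P; rewrite !mxE ?divfK //.
by apply: (mulIf y00); rewrite mulrAC divfK.
Qed.

Lemma om_mul A (x y : 'cV[K]_2) : om (A *m x) (A *m y) = \det A * om x y.
Proof. by rewrite /om !mulmx2 det2; ring. Qed.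

(** The kernel and the image are the same line K u, so the matrix is determined by [u] and a scalar;
    this makes traces of products computable. *)
Lemma nilpotent_form A : \tr A = 0 -> \det A = 0 -> A != 0 ->
  exists t u, [/\ t != 0, u != 0 & forall w, A *m w = (t * om u w) *: u].
Proof.
rewrite tr2 det2 => trA detA A0.
have A11 : A 1 1 = - A 0 0 by apply/eqP; rewrite -addr_eq0 addrC trA.
have sq : A 0 0 ^+ 2 = - (A 0 1 * A 1 0).
  by apply/eqP; rewrite -addr_eq0 -oppr_eq0 -detA A11; apply/eqP; ring.
have colE (a b : K) : (\col_i (if i == 0 then a else b) : 'cV[K]_2) 0 0 = a
    /\ (\col_i (if i == 0 then a else b) : 'cV[K]_2) 1 0 = b by rewrite !mxE.
have [A01|A01] := eqVneq (A 0 1) 0.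
  have A00 : A 0 0 = 0 by apply/eqP; rewrite -sqrf_eq0 sq A01 mul0r oppr0.
  have A10 : A 1 0 != 0.
    apply: contraNneq A0 => A10; apply/eqP.
    by apply: mx2P; rewrite mxE ?A11 ?A00 ?oppr0.
  exists (- A 1 0), (\col_i (if i == 0 then 0 else 1)); have [c0 c1] := colE 0 1.
  split; first by rewrite oppr_eq0.
    by apply/eqP => u0; move: c1; rewrite u0 mxE => /eqP; rewrite eq_sym oner_eq0.
  move=> w; apply: cV2P; rewrite mulmx2 [RHS]mxE /om c0 c1 ?A11 A00 ?A01; ring.
set b := A 0 1 in A01 sq *; have A10 : A 1 0 = - (A 0 0 ^+ 2 / b).
  by rewrite sq; field.
exists b, (\col_i (if i == 0 then 1 else - A 0 0 / b)).
have [c0 c1] := colE 1 (- A 0 0 / b); split=> //.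
  by apply/eqP => u0; move: c0; rewrite u0 mxE => /eqP; rewrite eq_sym oner_eq0.
move=> w; apply: cV2P; rewrite mulmx2 [RHS]mxE /om c0 c1 ?A11 ?A10 -/b; field.
all: done.
Qed.

Lemma SL2_om A (x y : 'cV[K]_2) : SL2 A -> om (A *m x) (A *m y) = om x y.
Proof. by move=> A1; rewrite om_mul A1 mul1r. Qed.

Lemma tr_rank1 A t u B (s : K) w : (forall x : 'cV_2, A *m x = (t * om u x) *: u) ->
  (forall x : 'cV_2, B *m x = (s * om w x) *: w) ->
  \tr (A *m B) = - (t * s * om u w ^+ 2).
Proof.
move=> Af Bf.
have AE i j : A i j = (A *m delta_mx j (0 : 'I_1)) i 0.
  by rewrite -colE mxE.
have BE i j : B i j = (B *m delta_mx j (0 : 'I_1)) i 0.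
  by rewrite -colE mxE.
rewrite tr2 !mulmx2 !AE !BE !Af !Bf /om !mxE /= ?(mulr0, mulr1, subr0, sub0r).
ring.
Qed.

(** B X B^-1 has the shape of X with [B *m u] in place of [u], so the trace is minus the square of t
    om(u, Bu), and its vanishing makes the two vectors proportional. *)
Lemma unipotents_common_line X B u t : SL2 B -> t != 0 ->
  (forall w, X *m w = (t * om u w) *: u) ->
  \tr (X *m (B *m X *m invmx B)) = 0 -> u != 0 -> collinear (B *m u) u.
Proof.
move=> B1 t0 Xf tr0 u0; have Bu := SL2_unit B1.
have X'f w : B *m X *m invmx B *m w = (t * om (B *m u) w) *: (B *m u).
  by rewrite -!mulmxA Xf -scalemxAr -(SL2_om _ _ B1) !mulmxA mulmxV // mul1mx.
have := tr_rank1 Xf X'f; rewrite tr0 => /eqP; rewrite eq_sym oppr_eq0.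
rewrite !mulf_eq0 (negPf t0) /= orbb => /eqP om0.
apply: om_collinear => //; move: om0; rewrite /om => om0.
by apply/eqP; rewrite -oppr_eq0 -om0; apply/eqP; ring.
Qed.

(** * Discreteness near the identity *)

Section Words.
Variables (r : nat) (h : 'I_r -> 'M[K]_2).
Hypothesis h1 : forall i, SL2 (h i).

Definition winv (w : word r) : word r := rev [seq (l.1, ~~ l.2) | l <- w].

Lemma letter_SL2 l : SL2 (letter h l).
Proof. by case: l => i [] /=; rewrite /letter /=; [apply: SL2_invmx|]. Qed.

Lemma eval_SL2 w : SL2 (eval_word h w).
Proof. by elim: w => [|l w IHw] /=; [apply: SL2_1 | apply: SL2_mul (letter_SL2 l) IHw]. Qed.

Lemma eval_cat w1 w2 : eval_word h (w1 ++ w2) = eval_word h w1 *m eval_word h w2.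
Proof. by elim: w1 => [|l w IHw] /=; rewrite ?mul1mx // IHw mulmxA. Qed.

Lemma eval_letter l : eval_word h [:: l] = letter h l.
Proof. by rewrite /= mulmx1. Qed.

Lemma letter_inv l : letter h (l.1, ~~ l.2) = invmx (letter h l).
Proof. by case: l => i [] //=; rewrite /letter /= invmxK. Qed.

Lemma eval_winv w : eval_word h (winv w) = invmx (eval_word h w).
Proof.
elim: w => [|l w IHw]; first by rewrite /= invmx1.
rewrite /winv /= rev_cons -cats1 eval_cat -/(winv w) IHw eval_letter letter_inv.
rewrite -[invmx (_ *m _)]/((_ * _)^-1) invrM //; apply: SL2_unit.
  exact: letter_SL2.
exact: eval_SL2.
Qed.

Lemma gen_SL2 A : gen h A -> SL2 A.
Proof. by case=> w ->; apply: eval_SL2. Qed.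

Lemma gen1 : gen h 1%:M.
Proof. by exists [::]. Qed.

Lemma gen_mul A B : gen h A -> gen h B -> gen h (A *m B).
Proof. by move=> [w1 ->] [w2 ->]; exists (w1 ++ w2); rewrite eval_cat. Qed.

Lemma gen_inv A : gen h A -> gen h (invmx A).
Proof. by move=> [w ->]; exists (winv w); rewrite eval_winv. Qed.

Lemma gen_gen i : gen h (h i).
Proof. by exists [:: (i, false)]; rewrite eval_letter. Qed.

Lemma gen_exp A n : gen h A -> gen h (A ^+ n).
Proof.
move=> hA; elim: n => [|n IHn]; first by rewrite expr0; apply: gen1.
by rewrite exprS; apply: gen_mul.
Qed.

Lemma gen_ind (P : 'M[K]_2 -> Prop) : P 1%:M ->
  (forall i A, SL2 A -> P A -> P (h i *m A)) ->
  (forall i A, SL2 A -> P A -> P (invmx (h i) *m A)) -> forall A, gen h A -> P A.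
Proof.
move=> P1 Ph Pi A [w ->{A}]; elim: w => [//|[i b] w IHw] /=.
by case: b; rewrite /letter /=; [apply: Pi|apply: Ph] => //; apply: eval_SL2.
Qed.

Lemma gen_invariant_line (u : 'cV[K]_2) : (forall i, collinear (h i *m u) u) ->
  forall A, gen h A -> collinear (A *m u) u.
Proof.
move=> hu; apply: gen_ind => [|i A A1 [a Au]|i A A1 [a Au]].
- by exists 1; rewrite mul1mx scale1r.
- by case: (hu i) => b hb; exists (a * b); rewrite -mulmxA Au -scalemxAr hb scalerA.
- case: (hu i) => b hb; have hiu := SL2_unit (h1 i).
  exists (a / b); rewrite -mulmxA Au -scalemxAr -scalerA; congr (_ *: _).
  have [b0|b0] := eqVneq b 0.
    rewrite b0 invr0 scale0r; move: hb; rewrite b0 scale0r => hu0.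
    by rewrite -[u](mulKmx hiu) hu0 !mulmx0.
  by rewrite -{1}[u](scalerK b0) -hb -scalemxAr mulKmx.
Qed.

(** Discreteness at the identity with an explicit radius, so that one [N] can serve all the groups
    G_n. *)
Definition isolated1 N := forall A, gen h A -> mge N (A - 1%:M) -> A = 1%:M.

Lemma discrete_isolated1 : discrete v (gen h) -> exists N, isolated1 N.
Proof.
move=> /(_ _ gen1) [N NP]; exists N => A hA NA; apply: NP => // i j.
by apply/closeE; have := NA i j; rewrite !mxE.
Qed.

Lemma isolated1_discrete N : isolated1 N -> discrete v (gen h).
Proof.
move=> iso B hB; have [c cB] := mge_bound (invmx B).
have Bu := SL2_unit (gen_SL2 hB).
exists (N + c%:Z) => A hA NA; rewrite -[A](mulKVmx Bu).
suff -> : invmx B *m A = 1%:M by rewrite mulmx1.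
apply: iso; first by apply: gen_mul => //; apply: gen_inv.
rewrite -(mulVmx Bu) -mulmxBr.
have AB : mge (N + c%:Z) (A - B) by move=> i j; rewrite !mxE; apply/closeE/NA.
by apply: mgeW (mgeM cB AB); lia.
Qed.

(** Translating to the identity by A^-1 costs only [c], since on SL_2 the inverse has the same
    norm. *)
Lemma isolated1_eq N A B (c : nat) : isolated1 N -> gen h A -> gen h B ->
  mge (- c%:Z) A -> mge (N + c%:Z) (B - A) -> A = B.
Proof.
move=> iso hA hB cA AB; have Au := SL2_unit (gen_SL2 hA).
rewrite -[B](mulKVmx Au).
suff -> : invmx A *m B = 1%:M by rewrite mulmx1.
apply: iso; first by apply: gen_mul => //; apply: gen_inv.
rewrite -(mulVmx Au) -mulmxBr SL2_inv; last exact: gen_SL2.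
by apply: mgeW (mgeM (mge_adj2 cA) AB); lia.
Qed.

(** The powers A^(q^k) tend to 1, so they eventually enter the neighbourhood that meets the group
    trivially. *)
Lemma isolated_torsion (q : nat) A : vge 1 (q%:R : K) -> discrete v (gen h) ->
  gen h A -> mge 1 (A - 1%:M) -> exists k, A ^+ (q ^ k) = 1.
Proof.
move=> q1 /discrete_isolated1 [N iso] hA A1; exists `|N|%N; apply: iso.
  exact: gen_exp.
by apply: mgeW (mge_exprqk q1 _ A1); lia.
Qed.

End Words.

(** In characteristic p, (A - 1)^(p^k) = A^(p^k) - 1, which vanishes for some k because A is
    torsion; hence A - 1 is nilpotent. *)
Lemma small_unipotent p r (h : 'I_r -> 'M[K]_2) A : p \in [pchar K] ->
  (forall i, SL2 (h i)) -> discrete v (gen h) -> gen h A -> mge 1 (A - 1%:M) ->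
  \tr (A - 1%:M) = 0 /\ \det (A - 1%:M) = 0.
Proof.
move=> pK h1 hd hA A1.
have pM : p \in [pchar 'M[K]_2].
  rewrite inE (pcharf_prime pK) /=; apply/eqP.
  by rewrite -scaler_nat (pcharf0 pK) scale0r.
have p1 : vge 1 (p%:R : K) by rewrite (pcharf0 pK).
have [k Ak] := isolated_torsion p1 hd hA A1.
apply: (@nilpotent_mx2 _ (p ^ k)).
have frob m : (A - 1) ^+ (p ^ m) = A ^+ (p ^ m) - 1.
  elim: m => [|m IHm]; first by rewrite !expn0 !expr1.
  rewrite expnSr !exprM IHm.
  have := pFrobenius_autB_comm pM (commr1 (A ^+ (p ^ m))).
  by rewrite !pFrobenius_autE expr1n.
by rewrite [LHS]frob Ak subrr.
Qed.

(* In characteristic 0 a neighbourhood of 1 is torsion-free. In characteristic p the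
   elements A = 1 + X of a discrete group close to 1 are unipotent, and so are
   1 + X' = B A B^-1 and A (1 + X') for each generator B; hence \tr (X *m X') = 0,
   which forces B to fix the line fixed by A. *)
Lemma uniformly_isolated (c : nat) : exists N, forall r (h : 'I_r -> 'M[K]_2),
  (forall i, SL2 (h i)) -> discrete v (gen h) -> (forall i, mge (- c%:Z) (h i)) ->
  isolated1 h N \/
  exists u, u != 0 /\ forall A, gen h A -> collinear (A *m u) u.
Proof.
have [q q0 q1] := residue_nat.
have [qK|qK] := eqVneq (q%:R : K) 0; last first.
  exists (v q%:R + 1) => r h h1 hd _; left=> A hA A1.
  have [|k Ak] := isolated_torsion q1 hd hA.
    by apply: mgeW A1; have := vgeE qK q1; lia.
  exact: small_torsion_trivial_pow Ak.
have [p pK] := natf0_pchar q0 (introT eqP qK).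
(* The term 2c pays for conjugation by a generator: the conjugate of a small element is still
   congruent to 1 modulo pi, as [small_unipotent] requires. *)
exists (1 + c%:Z *+ 2) => r h h1 hd hc.
have [[A [hA smallA nA1]]|noA] := classic (exists A, [/\ gen h A,
    mge (1 + c%:Z *+ 2) (A - 1%:M) & A <> 1%:M]); last first.
  by left=> A hA smallA; apply: NNPP => nA1; apply: noA; exists A.
right; have smallA1 : mge 1 (A - 1%:M) by apply: mgeW smallA; lia.
have [trX detX] := small_unipotent pK h1 hd hA smallA1.
have [|t [u [t0 u0 Xf]]] := nilpotent_form trX detX.
  by rewrite subr_eq0; apply/eqP.
exists u; split=> //; apply: gen_invariant_line => // i.
set B := h i; set X := A - 1%:M in Xf trX detX *.
have Bu := SL2_unit (h1 i); pose A' := B *m A *m invmx B.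
have A'E : A' - 1%:M = B *m X *m invmx B.
  by rewrite /X mulmxBr mulmxBl mulmx1 mulmxV.
have hB : gen h B by apply: gen_gen.
have hA' : gen h A' by apply: gen_mul; [apply: gen_mul|apply: gen_inv].
have smallA' : mge 1 (A' - 1%:M).
  by rewrite A'E; apply: mge_conj (hc i) _ => //; rewrite opprK.
have [trA' _] := small_unipotent pK h1 hd hA' smallA'.
have [trAA' _] := small_unipotent pK h1 hd (gen_mul hA hA')
  (mge_mul_near1 ler01 smallA1 smallA').
apply: (unipotents_common_line (h1 i) t0 Xf) u0; rewrite -/B -A'E.
have -> : X *m (A' - 1%:M) = (A *m A' - 1%:M) - X - (A' - 1%:M).
  rewrite /X mulmxBr mulmxBl mulmx1 mul1mx; apply/matrixP => a b; rewrite !mxE; ring.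
have trB (C D : 'M[K]_2) : \tr (C - D) = \tr C - \tr D by apply: raddfB.
by rewrite trB (trB _ X) trAA' trX trA' !subr0.
Qed.

(** * Limits of sequences of groups *)

Definition eventually (P : nat -> Prop) := exists M : nat, forall n, (M <= n)%N -> P n.

Lemma ev_mono (P Q : nat -> Prop) : (forall n, P n -> Q n) ->
  eventually P -> eventually Q.
Proof. by move=> PQ [M MP]; exists M => n /MP /PQ. Qed.

Lemma ev_and (P Q : nat -> Prop) : eventually P -> eventually Q ->
  eventually (fun n => P n /\ Q n).
Proof.
by move=> [M MP] [M' MQ]; exists (M + M')%N => n Mn; split; [apply: MP|apply: MQ]; lia.
Qed.

Lemma ev_true (P : nat -> Prop) : (forall n, P n) -> eventually P.
Proof. by move=> allP; exists 0%N. Qed.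

Lemma ev_seq (T : eqType) (s : seq T) (P : T -> nat -> Prop) :
  (forall t, t \in s -> eventually (P t)) ->
  eventually (fun n => forall t, t \in s -> P t n).
Proof.
elim: s => [|a s IHs] sP; first by apply: ev_true.
have evs : eventually (fun n => forall t, t \in s -> P t n).
  by apply: IHs => t xs; apply: sP; rewrite inE xs orbT.
have eva : eventually (P a) by apply: sP; rewrite inE eqxx.
apply: ev_mono (ev_and eva evs) => n [Pa Ps] t.
by rewrite inE => /orP [/eqP -> //|/Ps].
Qed.

Lemma ev_fin (T : finType) (P : T -> nat -> Prop) : (forall t, eventually (P t)) ->
  eventually (fun n => forall t, P t n).
Proof.
move=> allP; have [|M MP] := @ev_seq T (enum T) P; first by move=> t _.
by exists M => n /MP PM t; apply: PM; rewrite mem_enum.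
Qed.

Lemma ev_exists (P : nat -> Prop) : eventually P -> exists n, P n.
Proof. by case=> M MP; exists M; apply: MP. Qed.

Definition mlim (u : nat -> 'M[K]_2) A :=
  forall N, eventually (fun n => mge N (u n - A)).

Lemma mcvg_mlim u A : mcvg v u A -> mlim u A.
Proof.
move=> uA N; apply: ev_fin => i; apply: ev_fin => j.
have [M MP] := uA i j N; exists M => n /MP /closeE.
by rewrite !mxE.
Qed.

Lemma mlim_cst A : mlim (fun=> A) A.
Proof. by move=> N; apply: ev_true => n; rewrite subrr; apply: mge0. Qed.

Lemma mlim_mul u w A B : mlim u A -> mlim w B -> mlim (fun n => u n *m w n) (A *m B).
Proof.
move=> uA wB N; have [a aA] := mge_bound A; have [b bB] := mge_bound B.
have evu := uA (`|N| + b%:Z); have evw := wB (`|N| + a%:Z).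
apply: ev_mono (ev_and evu evw) => n [un wn].
have -> : u n *m w n - A *m B =
    (u n - A) *m (w n - B) + A *m (w n - B) + (u n - A) *m B.
  by rewrite !(mulmxBl, mulmxBr); apply/matrixP => i j; rewrite !mxE; ring.
apply: mgeD; first apply: mgeD.
- by apply: mgeW (mgeM un wn); lia.
- by apply: mgeW (mgeM aA wn); lia.
- by apply: mgeW (mgeM un bB); lia.
Qed.

Lemma adj2B A B : adj2 (A - B) = adj2 A - adj2 B.
Proof. by apply: mx2P; rewrite !mxE //= opprD. Qed.

Lemma mlim_inv u A : (forall n, SL2 (u n)) -> SL2 A -> mlim u A ->
  mlim (fun n => invmx (u n)) (invmx A).
Proof.
move=> u1 A1 uA N; apply: ev_mono (uA N) => n un.
by rewrite !SL2_inv // -adj2B; apply: mge_adj2.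
Qed.

(* log of the sup norm of A, which is half the displacement of the base vertex *)
Definition lognorm A : nat := \max_i \max_j
  (if A i j == 0%R then 0 else `|Num.min 0%R (v (A i j))|)%N.

Lemma mge_lognorm A : mge (- (lognorm A)%:Z) A.
Proof.
move=> i j; have /= := leq_bigmax (F := fun i => \max_j
  (if A i j == 0%R then 0 else `|Num.min 0%R (v (A i j))|))%N i.
have /= := leq_bigmax (F := fun j =>
  (if A i j == 0%R then 0 else `|Num.min 0%R (v (A i j))|))%N j.
have [-> _ _|_] := eqVneq (A i j) 0; first by left.
by rewrite -/(lognorm A) => le1 le2; right; lia.
Qed.

Lemma lognorm_le A (c : nat) : mge (- c%:Z) A -> (lognorm A <= c)%N.
Proof.
move=> cA; apply/bigmax_leqP => i _; apply/bigmax_leqP => j _.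
case: eqP => // /eqP A0; have := vgeE A0 (cA i j); lia.
Qed.

Lemma lognorm1 : lognorm 1%:M = 0%N.
Proof. by apply/eqP; rewrite -leqn0; apply: lognorm_le; apply: mge1. Qed.

(** Entries all in pi O would put the determinant in pi^2 O, so the norm is at least 1 and the
    truncation at 0 in [lognorm] is harmless. *)
Lemma lognorm_attained A : SL2 A -> exists i j, A i j != 0 /\ v (A i j) <= - (lognorm A)%:Z.
Proof.
move=> A1; apply: NNPP => noij.
have smallA : mge (1 - (lognorm A)%:Z) A.
  move=> i j; have [->|A0] := eqVneq (A i j) 0; first by left.
  right; rewrite leNgt; apply/negP => lt_v; apply: noij; exists i, j.
  by split=> //; lia.
case lognA : (lognorm A) => [|m].
  have : vge 2 (\det A).
    rewrite lognA in smallA; rewrite det2.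
    by apply: vgeB; apply: (@vgeM 1 1); apply: smallA.
  by rewrite A1 => /(vgeE (oner_neq0 _)); rewrite v1.
have : (lognorm A <= m)%N by apply: lognorm_le; apply: mgeW smallA; lia.
by rewrite lognA ltnn.
Qed.

Definition flip (i : 'I_2) : 'I_2 := if i == 0 then 1 else 0.

(* columns satisfy om(x,z) y = om(y,z) x + om(x,y) z *)
Lemma plucker (X Y Z : 'M[K]_2) i j k l : (adj2 X *m Z) i j * Y k l =
  (-1) ^+ (i == l) * (adj2 Y *m Z) (flip l) j * X k (flip i)
  + (adj2 X *m Y) i l * Z k j.
Proof.
move: i j k l; apply: ord2P; apply: ord2P; apply: ord2P; apply: ord2P;
rewrite !mulmx2 /flip /= !mx2E /=; ring.
Qed.

(* 0-hyperbolicity of the tree, for a point Y farthest from the base vertex *)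
Lemma displacement_shortcut (X Y Z : 'M[K]_2) c : SL2 X -> SL2 Y -> SL2 Z ->
  (lognorm X <= lognorm Y)%N -> (lognorm Z <= lognorm Y)%N ->
  mge c (invmx X *m Y) -> mge c (invmx Y *m Z) -> mge c (invmx X *m Z).
Proof.
move=> X1 Y1 Z1 XY ZY; rewrite !SL2_inv // => cXY cYZ i j.
(* Dividing the Plucker relation by an entry of Y of largest norm bounds every entry of X^-1 Z: the
   norms of X and Z are absorbed by that of Y. *)
have [k [l [Y0 vY]]] := lognorm_attained Y1.
have: vge (c - (lognorm Y)%:Z) (Y k l * (adj2 X *m Z) i j).
  rewrite mulrC plucker; apply: vgeD.
    rewrite -mulrA; apply: vge_M0l.
      by case: (i == l); rewrite ?expr1 ?expr0; [apply: vgeN|]; apply: vge1.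
    by apply: vgeW (vgeM (cYZ _ _) (mge_lognorm X _ _)); lia.
  by apply: vgeW (vgeM (cXY _ _) (mge_lognorm Z _ _)); lia.
by move/(vge_divl Y0); apply: vgeW; lia.
Qed.

(** The least [j > 0] with no ascent after it works. Since [displacement_shortcut] compares a point
    only with its two neighbours, such a local maximum does the work of the farthest point. *)
Lemma local_max (f : nat -> nat) m : (1 < m)%N -> (f 0 <= f 1)%N ->
  (f m <= f m.-1)%N ->
  exists j, [/\ (0 < j < m)%N, (f j.-1 <= f j)%N & (f j.+1 <= f j)%N].
Proof.
move=> m1 f01 fm; pose P j := (0 < j)%N && (f j.+1 <= f j)%N.
have exP : exists j, P j by exists m.-1; rewrite /P prednK; lia.
case: (ex_minnP exP) => j /andP [j0 fj] minj; exists j; split=> //.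
  by have := minj m.-1; rewrite /P prednK; lia.
case: j j0 fj minj => [//|[//|j]] _ _ minj /=.
rewrite leqNgt; apply/negP => lt_f.
by have := minj j.+1; rewrite /P /= ltnn => /(_ (ltnW lt_f)).
Qed.

(** A bounded element is coded by its entries, scaled by pi^c into O and reduced modulo pi^(|N| +
    2c). Undoing the scaling costs [c] and leaves the precision N + c that [isolated1_eq] asks
    for. *)
Lemma gen_bounded_finite r (h : 'I_r -> 'M[K]_2) N (c : nat) :
  (forall i, SL2 (h i)) -> isolated1 h N ->
  exists s : seq 'M[K]_2, forall A, gen h A /\ mge (- c%:Z) A -> A \in s.
Proof.
move=> h1 iso; have [pi [pi0 vpi]] := uniformizer.
have pic0 : pi ^+ c != 0 by rewrite expf_neq0.
have vpic : v (pi ^+ c) = c%:Z by rewrite vX // vpi natz.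
have [s sP] := finite_quotient (`|N| + c + c).
pose near (x y : K) := vge (`|N| + c + c)%N%:Z (pi ^+ c * x - y).
pose R A (y : K * K * (K * K)) :=
  [/\ gen h A, mge (- c%:Z) A & [/\ near (A 0 0) y.1.1, near (A 0 1) y.1.2,
      near (A 1 0) y.2.1 & near (A 1 1) y.2.2]].
pose s2 := [seq (a, b) | a <- s, b <- s].
apply: (finite_of_code (R := R) (s := [seq (a, b) | a <- s2, b <- s2])).
  move=> A [hA cA].
  have code i j : exists2 y, y \in s & near (A i j) y.
    apply: sP; apply: (@vgeW (c%:Z + - c%:Z)); first lia.
    by apply: vgeM (cA i j); right; rewrite vpic.
  have [a sa Ra] := code 0 0; have [b sb Rb] := code 0 1.
  have [a' sa' Ra'] := code 1 0; have [b' sb' Rb'] := code 1 1.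
  by exists ((a, b), (a', b')); [apply: allpairs_f; apply: allpairs_f|].
move=> A B y [hA cA [A1 A2 A3 A4]] [hB cB [B1 B2 B3 B4]].
apply: (isolated1_eq (h1) iso hA hB cA).
have nearB (a b z : K) : near a z -> near b z -> vge (N + c) (b - a).
  move=> az bz; have := vgeB bz az.
  rewrite opprB addrA subrK -mulrBr => /(vge_divl pic0).
  by apply: vgeW; rewrite vpic; lia.
by apply: ord2P; apply: ord2P; rewrite !mxE; apply: nearB; eassumption.
Qed.

(** * Passing relations from the limit group to G_n *)

Section Limit.
Variables (r : nat) (gn : nat -> 'I_r -> 'M[K]_2) (g : 'I_r -> 'M[K]_2) (N : int).
Hypotheses (gn1 : forall n i, SL2 (gn n i)) (g1 : forall i, SL2 (g i)).
Hypothesis gn_g : forall i, mlim (fun n => gn n i) (g i).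
Hypothesis gn_iso : eventually (fun n => isolated1 (gn n) N).

Lemma mlim_letter l : mlim (fun n => letter (gn n) l) (letter g l).
Proof.
by case: l => i [] /=; rewrite /letter /=; [apply: mlim_inv|apply: gn_g].
Qed.

Lemma mlim_eval w : mlim (fun n => eval_word (gn n) w) (eval_word g w).
Proof.
elim: w => [|l w IHw]; first exact: mlim_cst.
exact: mlim_mul (mlim_letter l) IHw.
Qed.

(** If w(g) is close to 1, then so is w(g_n) for large n, with the same radius by the ultrametric
    inequality; thus w(g_n) = 1, and w(g) = 1 in the limit. *)
Lemma limit_isolated1 : isolated1 g N.
Proof.
move=> _ [w ->] small_w.
suff ev0 N' : mge N' (eval_word g w - 1%:M).
  by apply/eqP; rewrite -subr_eq0; apply/eqP/mge_all.
have evw := mlim_eval w (Num.max N N').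
have [n [iso nw]] := ev_exists (ev_and gn_iso evw).
have w1 : eval_word (gn n) w = 1%:M.
  apply: iso; first by exists w.
  rewrite -(subrKA (eval_word g w)); apply: mgeD => //.
  by apply: mgeW nw; lia.
by rewrite -opprB; apply: mgeN; rewrite -w1; apply: mgeW nw; lia.
Qed.

Lemma ev_eval1 w : eval_word g w = 1%:M -> eventually (fun n => eval_word (gn n) w = 1%:M).
Proof.
move=> w1; apply: ev_mono (ev_and gn_iso (mlim_eval w N)) => n [iso nw].
by apply: iso; [exists w|rewrite -w1].
Qed.

Lemma eval_eq_cat (h : 'I_r -> 'M[K]_2) w w' : (forall i, SL2 (h i)) ->
  (eval_word h w = eval_word h w') <->
  eval_word h (w ++ winv w') = 1%:M.
Proof.
move=> h1; rewrite eval_cat eval_winv //.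
have wu := SL2_unit (eval_SL2 h1 w'); split=> [->|ww]; first by rewrite mulmxV.
by rewrite -[LHS](mulmxKV wu) ww mul1mx.
Qed.

Lemma ev_eval_eq w w' : eval_word g w = eval_word g w' ->
  eventually (fun n => eval_word (gn n) w = eval_word (gn n) w').
Proof.
move=> /(eval_eq_cat _ _ g1) /ev_eval1; apply: ev_mono => n.
by move=> ww; apply/eval_eq_cat.
Qed.

Definition wd A : word r := epsilon (inhabits [::]) (fun w => A = eval_word g w).

Lemma wdP A : gen g A -> A = eval_word g (wd A).
Proof. by move=> hA; exact: (@epsilon_spec _ _ (fun w => A = eval_word g w) hA). Qed.

(** The candidate for psi_n: spell [A] by a chosen word and evaluate this word in G_n. Independence
    of the word and multiplicativity are established only for large n. *)
Definition lift_gen n A := eval_word (gn n) (wd A).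

Definition mprod (s : seq 'M[K]_2) : 'M[K]_2 := foldr mulmx 1%:M s.

Lemma mprod_cat s1 s2 : mprod (s1 ++ s2) = mprod s1 *m mprod s2.
Proof. by elim: s1 => [|A s IHs] /=; rewrite ?mul1mx // IHs mulmxA. Qed.

(* the farthest point of a closed path in the orbit of the base vertex can be skipped *)
Lemma lift_closed_path c (phi : 'M[K]_2 -> 'M[K]_2) :
  phi 1%:M = 1%:M ->
  (forall A B, gen g A -> gen g B -> mge c A -> mge c B -> mge c (A *m B) ->
    phi (A *m B) = phi A *m phi B) ->
  forall s, (forall A, A \in s -> gen g A /\ mge c A) -> mprod s = 1%:M ->
  mprod (map phi s) = 1%:M.
Proof.
move=> phi1 phiM s; have [m] := ubnP (size s); elim: m s => // m IHm s.
rewrite ltnS => sm sP s1.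
case: (leqP (size s) 1) => [|size1].
  case: s sm sP s1 => [|A [|]] //= _ _; rewrite mulmx1 => -> _.
  by rewrite phi1 mulmx1.
have mprodP t : {subset t <= s} -> gen g (mprod t).
  elim: t => [|A t IHt] ts; first exact: gen1.
  apply: gen_mul; first by have [] := sP A (ts _ (mem_head _ _)).
  by apply: IHt => B Bt; apply: ts; rewrite inE Bt orbT.
(* Displacements of the vertices visited by the path; the first and the last are 0, which yields an
   interior local maximum. *)
pose f k := lognorm (mprod (take k s)).
have [||j [/andP [j0 js] fj1 fj2]] := @local_max f (size s) size1.
- by rewrite {1}/f take0 lognorm1.
- by rewrite {1}/f take_size s1 lognorm1.
case: j j0 js fj1 fj2 => // j _ js /= fj1 fj2.
set A := nth 0 s j; set B := nth 0 s j.+1.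
have takeS k : (k < size s)%N -> take k.+1 s = take k s ++ [:: nth 0 s k].
  by move=> ks; rewrite (take_nth 0 ks) cats1.
have sE : s = take j s ++ [:: A; B] ++ drop j.+2 s.
  by rewrite -[LHS](cat_take_drop j) (drop_nth 0 (ltnW js)) (drop_nth 0 js).
have [hA cA] : gen g A /\ mge c A by apply: sP; apply: mem_nth; apply: ltnW.
have [hB cB] : gen g B /\ mge c B by apply: sP; apply: mem_nth.
set X := mprod (take j s); have hX : gen g X by apply: mprodP; apply: mem_take.
have XA : mprod (take j.+1 s) = X *m A.
  by rewrite takeS ?(ltnW js) // mprod_cat /= mulmx1.
have XAB : mprod (take j.+2 s) = X *m A *m B.
  by rewrite takeS // mprod_cat /= mulmx1 XA.
have Xu := SL2_unit (gen_SL2 g1 hX); have hXA := gen_mul hX hA.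
have XAu := SL2_unit (gen_SL2 g1 hXA).
(* Of the consecutive vertices X, XA, XAB the middle one is farthest, so AB obeys the same bound as
   A and B and can replace them, shortening the path. *)
have cAB : mge c (A *m B).
  have := @displacement_shortcut X (X *m A) (X *m A *m B) c.
  rewrite mulKmx // mulKmx // -(mulmxA X) mulKmx //; apply=> //.
  - exact: gen_SL2 hX.
  - exact: gen_SL2 hXA.
  - by rewrite mulmxA; apply: gen_SL2 (gen_mul hXA hB).
  - by rewrite -XA.
  - by rewrite mulmxA -XAB -XA.
rewrite sE !map_cat !mprod_cat /= mulmx1 -phiM //.
have := IHm (take j s ++ [:: A *m B] ++ drop j.+2 s).
rewrite !map_cat !mprod_cat /= !mulmx1; apply.
- rewrite !size_cat /= size_take size_drop (ltnW js).
  by move: sm js; clear; move: (size s) => k; lia.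
- move=> C; rewrite !mem_cat inE => /or3P [/mem_take /sP //|/eqP ->|/mem_drop /sP //].
  by split=> //; apply: gen_mul.
- by move: s1; rewrite {1}sE !mprod_cat /= mulmx1.
Qed.

Lemma ev_homomorphism : eventually (fun n => forall w w',
  eval_word g w = eval_word g w' -> eval_word (gn n) w = eval_word (gn n) w').
Proof.
(* [c] bounds the generators and their inverses, so that every word is a path with steps in T. *)
have [c cP] : exists c : nat, forall l, mge (- c%:Z) (letter g l).
  have bP l := mge_bound (letter g l).
  pose b l := proj1_sig (constructive_indefinite_description _ (bP l)).
  exists (\max_l b l)%N => l.
  apply: mgeW (proj2_sig (constructive_indefinite_description _ (bP l))).
  by have := leq_bigmax (F := b) l; rewrite /b; lia.
have [t tP] := gen_bounded_finite c g1 limit_isolated1.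
have hl l : gen g (letter g l) by exists [:: l]; rewrite eval_letter.
have ev1 : eventually (fun n => lift_gen n 1%:M = 1%:M).
  by apply: ev_eval1; rewrite -wdP //; apply: gen1.
have evl : eventually (fun n => forall l, lift_gen n (letter g l) = letter (gn n) l).
  apply: ev_fin => l; have := @ev_eval_eq (wd (letter g l)) [:: l].
  rewrite -wdP // eval_letter => /(_ erefl); apply: ev_mono => n.
  by rewrite eval_letter.
(* The list [t] contains the bounded elements of G but may contain other matrices; the guard sets
   these aside. *)
have evM : eventually (fun n => forall A, A \in t -> forall B, B \in t ->
    gen g A /\ gen g B -> lift_gen n (A *m B) = lift_gen n A *m lift_gen n B).
  apply: ev_seq => A _; apply: ev_seq => B _.
  have [[hA hB]|nh] := classic (gen g A /\ gen g B); last by apply: ev_true => n /nh.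
  have := @ev_eval_eq (wd (A *m B)) (wd A ++ wd B).
  rewrite eval_cat -!wdP //; last exact: gen_mul.
  move=> /(_ erefl); apply: ev_mono => n; by rewrite eval_cat.
apply: ev_mono (ev_and ev1 (ev_and evl evM)) => n [n1 [nl nM]] w w'.
move/(eval_eq_cat _ _ g1) => ww1; apply/eval_eq_cat => //.
move: (w ++ winv w') ww1 => {}w w1.
have evalE h : eval_word h w = mprod (map (letter h) w).
  by rewrite /eval_word; elim: (w) => //= l w0 ->.
have := @lift_closed_path (- c%:Z) (lift_gen n) n1 _ (map (letter g) w) _.
rewrite -evalE => /(_ _ _ w1); rewrite -map_comp evalE.
rewrite (eq_map (nl : lift_gen n \o letter g =1 letter (gn n))).
apply=> [A B hA hB cA cB _|A /mapP [l _ ->]]; last by split.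
by apply: nM => //; apply: tP.
Qed.

End Limit.

Implicit Types (M : 'M[K]_2).

(** * Rays, ends and invariant lines *)

(* GL_2(O) *)
Definition GO A := [/\ mge 0 A, \det A != 0 & v (\det A) = 0].

Lemma GO_unit A : GO A -> A \in unitmx.
Proof. by case=> _ dA _; rewrite unitmx_det. Qed.

Lemma GO_mul A B : GO A -> GO B -> GO (A *m B).
Proof.
move=> [A0 dA vA] [B0 dB vB]; split.
- exact: (mgeM A0 B0).
- by rewrite det_mulmx mulf_neq0.
- by rewrite det_mulmx vM // vA vB.
Qed.

Lemma GO_inv A : GO A -> GO (invmx A).
Proof.
move=> GA; have Au := GO_unit GA; case: GA => A0 dA vA; split.
- rewrite invmx2 //; apply: (@mgeZ 0 0); last exact: mge_adj2.
  by right; rewrite vV // vA.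
- by rewrite det_inv invr_eq0.
- by rewrite det_inv vV // vA.
Qed.

Lemma GO_1 : GO 1%:M.
Proof. by split; [apply: mge1|rewrite det1 oner_neq0|rewrite det1 v1]. Qed.

Lemma GO_of_mul A B : mge 0 A -> mge 0 B -> A *m B = 1%:M -> GO A /\ GO B.
Proof.
move=> A0 B0 AB; have dAB : \det A * \det B = 1 by rewrite -det_mulmx AB det1.
have dA : \det A != 0.
  by apply/eqP => dA; move/eqP: dAB; rewrite dA mul0r eq_sym oner_eq0.
have dB : \det B != 0.
  by apply/eqP => dB; move/eqP: dAB; rewrite dB mulr0 eq_sym oner_eq0.
have vA := vgeE dA (mge_det A0); have vB := vgeE dB (mge_det B0).
have := vM dA dB; rewrite dAB v1 => vAB.
by split; split=> //; lia.
Qed.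

(* the columns of A and B span homothetic O-lattices *)
Definition hom A B := exists (c : K) (N : 'M[K]_2), [/\ c != 0, GO N & A = c *: (B *m N)].

Lemma hom_refl A : hom A A.
Proof. by exists 1, 1%:M; split; rewrite ?oner_neq0 ?mulmx1 ?scale1r //; apply: GO_1. Qed.

Lemma hom_sym A B : hom A B -> hom B A.
Proof.
move=> [c [N [c0 GN ->]]]; exists c^-1, (invmx N).
split; [by rewrite invr_eq0|exact: GO_inv|].
by rewrite -scalemxAl mulmxK ?GO_unit // scalerK.
Qed.

Lemma hom_trans A B C : hom A B -> hom B C -> hom A C.
Proof.
move=> [c [N [c0 GN ->]]] [d [M [d0 GM ->]]]; exists (c * d), (M *m N).
split; [by rewrite mulf_neq0|exact: GO_mul|].
by rewrite -scalemxAl scalerA mulmxA.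
Qed.

Lemma hom_mull A B C : hom A B -> hom (C *m A) (C *m B).
Proof. by move=> [c [N [c0 GN ->]]]; exists c, N; rewrite -scalemxAr mulmxA. Qed.

Lemma hom_mull_cancel A B C : C \in unitmx -> hom (C *m A) (C *m B) -> hom A B.
Proof. by move=> Cu /(hom_mull (invmx C)); rewrite !mulKmx. Qed.

Lemma hom_GO A B : GO B -> hom (A *m B) A.
Proof. by move=> GB; exists 1, B; split; rewrite ?oner_neq0 ?scale1r. Qed.

Lemma hom_scale A c : c != 0 -> hom (c *: A) A.
Proof. by move=> c0; exists c, 1%:M; split=> //; [apply: GO_1|rewrite mulmx1]. Qed.

Lemma lat_sub A M : mge 0 M -> set_subP (lat v (A *m M)) (lat v A).
Proof.
move=> M0 _ [c [c0 ->]]; exists (M *m c); split; last by rewrite mulmxA.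
have cO : mge 0 c by move=> j k; rewrite ord1; apply: c0.
by move=> i; apply: (mgeM M0 cO).
Qed.

Lemma lat_subE A B : A \in unitmx -> set_subP (lat v B) (lat v A) ->
  exists2 M, mge 0 M & B = A *m M.
Proof.
move=> Au BA; exists (invmx A *m B); last by rewrite mulKVmx.
move=> i j; have [|c [c0 Bc]] := BA (B *m delta_mx j 0).
  exists (delta_mx j 0); split=> // k.
  by rewrite mxE; case: (_ && _); [right; rewrite v1|left].
suff -> : (invmx A *m B) i j = c i 0 by apply: c0.
by rewrite -[c](mulKmx Au) -Bc mulmxA -colE !mxE.
Qed.

(** Two bases of one lattice differ by integral matrices inverse to each other, that is, by an
    element of GL_2(O). This replaces lattices by a matrix relation. *)
Lemma homotheticE A B : A \in unitmx -> B \in unitmx ->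
  homothetic v A B <-> hom A B.
Proof.
move=> Au Bu; split=> [[c [c0 eqAB]]|[c [N [c0 GN ->]]]].
  have cAu : c *: A \in unitmx.
    by rewrite unitmx_det detZ mulf_neq0 ?expf_neq0 // -unitmx_det.
  have [M M0 BM] := lat_subE cAu (fun w Bw => (eqAB w).2 Bw).
  have [M' M0' AM] := lat_subE Bu (fun w Aw => (eqAB w).1 Aw).
  have MM : M' *m M = 1%:M by rewrite -(mulKmx Bu (M' *m M)) (mulmxA B) -AM -BM mulVmx.
  have [GM _] := GO_of_mul M0' M0 MM.
  by exists c^-1, M'; split=> //; rewrite ?invr_eq0 // -AM scalerK.
exists c^-1; split; first by rewrite invr_eq0.
rewrite scalerK // => w; split; first by apply: lat_sub; case: GN.
by rewrite -{1}[B](mulmxK (GO_unit GN)) => Bx; apply: lat_sub Bx; case: (GO_inv GN).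
Qed.

(** The two inclusions give integral M and M' with M M' = pi, so the valuations of their
    determinants add up to 2; strictness excludes 0, leaving 1 for each. *)
Lemma adjacentE A B : A \in unitmx -> B \in unitmx -> adjacent v A B ->
  exists (c : K) (M : 'M[K]_2), [/\ c != 0, mge 0 M, \det M != 0, v (\det M) = 1
    & B = c *: (A *m M)].
Proof.
move=> Au Bu [pi [c [pi0 vpi c0 [sub1 neq1] [sub2 neq2]]]].
have scale_unit d C : d != 0 -> C \in unitmx -> d *: C \in unitmx.
  by move=> d0; rewrite !unitmx_det detZ => C0; rewrite mulf_neq0 ?expf_neq0.
have cBu := scale_unit c B c0 Bu.
have [M M0 cBE] := lat_subE Au sub2.
have [M' M0' piAE] := lat_subE cBu sub1.
have MM : M *m M' = pi%:M.
  by rewrite -(mulKmx Au (M *m M')) (mulmxA A) -cBE -piAE -scalemxAr mulVmx // scalemx1.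
have dMM : \det M * \det M' = pi ^+ 2 by rewrite -det_mulmx MM det_scalar.
have : \det M * \det M' != 0 by rewrite dMM expf_neq0.
rewrite mulf_eq0 negb_or => /andP [dM dM'].
have vMM : v (\det M) + v (\det M') = 2 by rewrite -vM // dMM vX // vpi.
have vM0 : v (\det M) <> 0.
  move=> vM0; have GM : GO M by [].
  case: neq2 => w; split; first exact: sub2.
  rewrite cBE -{1}[A](mulmxK (GO_unit GM)) => Ax.
  by apply: lat_sub Ax; case: (GO_inv GM).
have vM'0 : v (\det M') <> 0.
  move=> vM'0; have GM : GO M' by [].
  case: neq1 => w; split; first exact: sub1.
  rewrite piAE -{1}[c *: B](mulmxK (GO_unit GM)) => Ax.
  by apply: lat_sub Ax; case: (GO_inv GM).
have := vgeE dM (mge_det M0); have := vgeE dM' (mge_det M0') => vM1 vM2.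
exists c^-1, M; split=> //; first by rewrite invr_eq0.
  lia.
by rewrite -cBE scalerK.
Qed.

Section Rays.
Variable pi : K.
Hypotheses (pi0 : pi != 0) (vpi : v pi = 1).

(* P *m Dk k spans the lattice O e + pi^k O f, where e and f are the columns of P;
   as k grows these vertices form a ray towards the end given by the line K e *)
Definition Dk k : 'M[K]_2 := mx2 1 0 0 (pi ^+ k).
Lemma det_Dk k : \det (Dk k) = pi ^+ k.
Proof. by rewrite det_mx2 mul1r mul0r subr0. Qed.

(** Replaces the basis vector e by e + x f. The vertex [Lx x *m Dk k] depends only on x modulo pi^k,
    so following a ray determines x digit by digit. *)
Definition Lx (x : K) : 'M[K]_2 := mx2 1 0 x 1.

Lemma pik0 k : pi ^+ k != 0. Proof. by rewrite expf_neq0. Qed.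

Lemma vpik k : v (pi ^+ k) = k%:Z. Proof. by rewrite vX // vpi natz. Qed.

Lemma Dk_unit k : Dk k \in unitmx.
Proof. by rewrite unitmx_det det2 !mx2E mul1r mul0r subr0 pik0. Qed.

Lemma Lx_unit x : Lx x \in unitmx.
Proof. by rewrite unitmx_det det2 !mx2E mul1r mul0r subr0 oner_neq0. Qed.

Lemma GO_Lx x : vge 0 x -> GO (Lx x).
Proof.
have dL : \det (Lx x) = 1 by rewrite det2 !mx2E; ring.
by move=> x0; split; rewrite ?dL ?oner_neq0 ?v1 //; apply: mge_mx2 => //; apply: vge1.
Qed.

Lemma DkD k m : Dk (k + m) = Dk k *m Dk m.
Proof. by apply: mx2P; rewrite mulmx2 !mx2E ?exprD; ring. Qed.

Lemma LxD x y : Lx (x + y) = Lx x *m Lx y.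
Proof. by apply: mx2P; rewrite mulmx2 !mx2E; ring. Qed.

Lemma Lx_Dk x k : Lx (pi ^+ k * x) *m Dk k = Dk k *m Lx x.
Proof. by apply: mx2P; rewrite !mulmx2 !mx2E; ring. Qed.

Lemma hom_Lx x y k : vge k%:Z (x - y) -> hom (Lx x *m Dk k) (Lx y *m Dk k).
Proof.
move=> xy; rewrite -[x](subrK y) addrC LxD -mulmxA; apply: hom_mull.
have -> : x - y = pi ^+ k * ((x - y) / pi ^+ k) by rewrite mulrC divfK ?pik0.
rewrite Lx_Dk; apply/hom_GO/GO_Lx; move: xy.
rewrite -{1}[x - y](divfK (pik0 k)) mulrC => /(vge_divl (pik0 k)).
by apply: vgeW; rewrite vpik; lia.
Qed.

Lemma hom_Lx_inv x y k : hom (Lx x *m Dk k) (Lx y *m Dk k) -> vge k%:Z (x - y).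
Proof.
move=> [c [N [c0 [N0 dN vN] E]]].
have e i j : (Lx x *m Dk k) i j = c * (Lx y *m Dk k *m N) i j by rewrite E mxE.
have := e 0 0; have := e 0 1; have := e 1 0; have := e 1 1.
rewrite !mulmx2 !mx2E !(mul1r, mulr1, mul0r, mulr0, addr0, add0r).
move=> e11 e10 e01 e00.
have vc : v c = 0.
  move/eqP: e01; rewrite eq_sym mulf_eq0 (negPf c0) /= => /eqP N01.
  move: e11; rewrite N01 mulr0 add0r mulrCA => /esym.
  rewrite -[RHS]mulr1 => /(mulfI (pik0 k)) e11.
  have c2 : c ^+ 2 * \det N = 1.
    by rewrite det2 N01 mul0r subr0 expr2 mulrACA -e00 e11 mulr1.
  have := vM (expf_neq0 2 c0) dN; rewrite c2 vN v1 vX //; lia.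
have -> : x - y = c * (pi ^+ k * N 1 0).
  by rewrite e10 mulrDr mulrCA -e00 mulr1 addrC addKr.
apply: vge_M0l; first by right; rewrite vc.
by apply: vge_M0r; [right; rewrite vpik|apply: N0].
Qed.

(** Neighbours of a vertex are the points of the projective line over the residue field: infinity in
    the first alternative, a finite point [t] in the second. The case depends on whether the first
    row of [M] contains a unit. *)
Lemma adjacent_factor M : mge 0 M -> \det M != 0 -> v (\det M) = 1 ->
  exists2 N, GO N & M = mx2 pi 0 0 1 *m N \/
                    exists2 t, vge 0 t & M = Lx t *m Dk 1 *m N.
Proof.
move=> M0 dM vdM.
have unitO x : x != 0 -> v x = 0 -> vge 0 x^-1 by move=> x0 vx; right; rewrite vV // vx.
have divpi x : vge 1 x -> vge 0 (x / pi).
  by move=> x1; apply: (vgeM x1 (M := -1)); right; rewrite vV // vpi.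
have dMpi : \det M / pi != 0 by rewrite mulf_neq0 ?invr_eq0.
have vdMpi : v (\det M / pi) = 0 by rewrite vM ?invr_eq0 // vV // vpi vdM.
have dMpiO : vge 0 (\det M / pi) by right; rewrite vdMpi.
have size1 x : vge 0 x -> vge 1 x \/ x != 0 /\ v x = 0.
  case=> [->|x0]; first by left; left.
  have [->|xn0] := eqVneq x 0; first by left; left.
  have [vx|vx] := eqVneq (v x) 0; first by right.
  by left; right; lia.
have [a1|[a0 va]] := size1 _ (M0 0 0).
  have [b1|[b0 vb]] := size1 _ (M0 0 1).
    exists (mx2 (M 0 0 / pi) (M 0 1 / pi) (M 1 0) (M 1 1)); last first.
      by left; apply: mx2P; rewrite mulmx2 !mx2E; field.
    have dE : \det (mx2 (M 0 0 / pi) (M 0 1 / pi) (M 1 0) (M 1 1)) = \det M / pi.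
      by rewrite !det2 !mx2E; field.
    by split; rewrite ?dE //; apply: mge_mx2 => //; apply: divpi.
  set b := M 0 1 in b0 vb.
  exists (mx2 (M 0 0) b (- (\det M / pi / b)) 0).
    split; rewrite ?det_mx2 ?mulr0 ?sub0r ?mulrN ?opprK.
    - apply: mge_mx2 => //; try exact: M0.
      by apply: vgeN; apply: vge_M0l => //; apply: unitO.
    - by rewrite mulrC divfK.
    - by rewrite mulrC divfK.
  right; exists (M 1 1 / b); first by apply: vge_M0l (M0 _ _) (unitO _ b0 vb).
  apply: mx2P; rewrite !mulmx2 !mx2E ?expr1 ?det2 -/b; field.
  all: rewrite ?pi0 ?b0 //.
set a := M 0 0 in a0 va.
exists (mx2 a (M 0 1) 0 (\det M / pi / a)).
  split; rewrite ?det_mx2 ?mulr0 ?subr0.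
  - apply: mge_mx2 => //; try exact: M0.
    by apply: vge_M0l => //; apply: unitO.
  - by rewrite mulrC divfK.
  - by rewrite mulrC divfK.
right; exists (M 1 0 / a); first by apply: vge_M0l (M0 _ _) (unitO _ a0 va).
apply: mx2P; rewrite !mulmx2 !mx2E ?expr1 ?det2 -/a; field.
all: rewrite ?pi0 ?a0 //.
Qed.

Lemma ray_unit rr k : ray v rr -> rr k \in unitmx.
Proof. by move=> /(_ k) []. Qed.

Lemma ray_step rr k : ray v rr -> exists (c : K) M, [/\ c != 0, mge 0 M, \det M != 0,
  v (\det M) = 1 & rr k.+1 = c *: (rr k *m M)].
Proof.
by move=> rP; case: (rP k) => u adj _; apply: adjacentE => //; apply: ray_unit.
Qed.

Lemma ray_start rr : ray v rr ->
  exists2 P, P \in unitmx & hom (rr 0%N) (P *m Dk 0) /\ hom (rr 1%N) (P *m Dk 1).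
Proof.
move=> rP; have [c [M [c0 M0 dM vdM rE]]] := ray_step 0 rP.
have D0 : Dk 0 = 1%:M by apply: mx2P; rewrite !mxE.
have ru := ray_unit 0 rP.
have [N GN [ME|[t t0 ME]]] := adjacent_factor M0 dM vdM.
  (* Exchanging the basis vectors turns the neighbour at infinity into a finite one. *)
  pose S : 'M[K]_2 := mx2 0 1 1 0.
  have SS : S *m S = 1%:M by apply: mx2P; rewrite mulmx2 !mxE /=; ring.
  have GS : GO S.
    have S0 : mge 0 S by apply: mge_mx2 => //; apply: vge1.
    by have [] := GO_of_mul S0 S0 SS.
  exists (rr 0%N *m S); first by rewrite unitmx_mul ru GO_unit.
  rewrite D0 mulmx1; split; first exact/hom_sym/hom_GO.
  have -> : rr 1%N = c *: (rr 0%N *m S *m Dk 1 *m (S *m N)).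
    rewrite rE ME !mulmxA; congr (_ *: (_ *m _)); rewrite -!mulmxA; congr (_ *m _).
    by apply: mx2P; rewrite !mulmx2 !mx2E ?expr1; ring.
  by apply: hom_trans (hom_scale _ c0) _; apply/hom_GO/GO_mul.
exists (rr 0%N *m Lx t); first by rewrite unitmx_mul ru Lx_unit.
rewrite D0 mulmx1; split; first exact/hom_sym/hom_GO/GO_Lx.
rewrite rE ME !mulmxA; apply: hom_trans (hom_scale _ c0) _.
exact: hom_GO.
Qed.

(** Among the neighbours of [rr k.+1], the one at infinity is [rr k], excluded since a ray does not
    backtrack; any other one adds a digit [pi ^+ k.+1 * t] to [x]. *)
Lemma ray_extend rr P x k : ray v rr ->
  hom (rr k) (P *m (Lx x *m Dk k)) -> hom (rr k.+1) (P *m (Lx x *m Dk k.+1)) ->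
  exists2 y, vge k.+1%:Z (x - y) & hom (rr k.+2) (P *m (Lx y *m Dk k.+2)).
Proof.
move=> rP hk hk1; have [c [M0 [c0 M00 dM0 vdM0 rE0]]] := ray_step k.+1 rP.
have [d [N1 [d0 GN1 rE]]] := hk1.
have N1u := GO_unit GN1; case: (GN1) => N10 dN1 vN1.
pose M := N1 *m M0.
have M1 : mge 0 M by apply: (mgeM N10 M00).
have dM : \det M != 0 by rewrite det_mulmx mulf_neq0.
have vdM : v (\det M) = 1 by rewrite det_mulmx vM // vN1 vdM0.
have {rE0} hk2 : hom (rr k.+2) (P *m (Lx x *m Dk k.+1) *m M).
  rewrite rE0 rE -scalemxAl scalerA -!mulmxA.
  by apply: hom_scale; rewrite mulf_neq0.
have [N GN [ME|[t t0 ME]]] := adjacent_factor M1 dM vdM.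
  case: (rP k) => ru _ []; apply/homotheticE => //; first exact: ray_unit.
  apply: hom_trans hk _; apply: hom_sym; apply: hom_trans hk2 _.
  rewrite ME (mulmxA _ (mx2 _ _ _ _)); apply: hom_trans (hom_GO _ GN) _.
  have -> : P *m (Lx x *m Dk k.+1) *m mx2 pi 0 0 1 = pi *: (P *m (Lx x *m Dk k)).
    rewrite scalemxAr -mulmxA; congr (_ *m _).
    rewrite scalemxAr -mulmxA; congr (_ *m _).
    by apply: mx2P; rewrite mulmx2 [RHS]mxE !mx2E ?exprS; ring.
  exact: hom_scale.
exists (x + pi ^+ k.+1 * t).
  rewrite opprD addNKr; apply/vgeN.
  by apply: vge_M0r => //; right; rewrite vpik.
apply: hom_trans hk2 _; rewrite ME (mulmxA _ (Lx t *m Dk 1)); apply: hom_trans (hom_GO _ GN) _.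
rewrite (_ : P *m _ *m _ = P *m (Lx (x + pi ^+ k.+1 * t) *m Dk k.+2)).
  exact: hom_refl.
by rewrite LxD -(addn1 k.+1) DkD -!mulmxA (mulmxA (Lx (_ * _))) Lx_Dk !mulmxA.
Qed.

(* the approximations x_k with rr j ~ P *m (Lx x_k *m Dk j) for j <= k + 1 converge *)
Lemma ray_normal_form rr : ray v rr ->
  exists2 P, P \in unitmx & forall k, hom (rr k) (P *m Dk k).
Proof.
move=> rP; have [P Pu [h0 h1]] := ray_start rP.
have L0 : Lx 0 = 1%:M by apply: mx2P; rewrite !mxE.
have approx k : exists x, forall j, (j <= k.+1)%N -> hom (rr j) (P *m (Lx x *m Dk j)).
  elim: k => [|k [x IHk]].
    by exists 0 => -[|[|//]] _; rewrite L0 mul1mx.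
  have [y xy hy] := ray_extend rP (IHk k (leqnSn k)) (IHk k.+1 (leqnn _)).
  exists y => j; rewrite leq_eqVlt => /predU1P [-> //|jk].
  apply: hom_trans (IHk j jk) _; apply/hom_mull/hom_Lx.
  by apply: vgeW xy; lia.
pose x k := proj1_sig (constructive_indefinite_description _ (approx k)).
have xP k j : (j <= k.+1)%N -> hom (rr j) (P *m (Lx (x k) *m Dk j)).
  exact: (proj2_sig (constructive_indefinite_description _ (approx k))).
(* Both [x k] and [x k.+1] describe the vertex [rr k], hence they agree modulo pi^k. *)
have [|y yP] := @series_cvg x.
  move=> k; apply: hom_Lx_inv; apply: (hom_mull_cancel Pu).
  by apply: hom_trans (hom_sym (xP _ _ _)) (xP _ _ _); lia.
exists (P *m Lx y) => [|k]; first by rewrite unitmx_mul Pu Lx_unit.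
apply: hom_trans (xP k k (leqnSn k)) _; rewrite -mulmxA; apply/hom_mull/hom_Lx.
by rewrite -opprB; apply: vgeN.
Qed.

(** [M] fixes the end given by K e exactly when it preserves this line. If the tails agree up to a
    shift, the determinant determines v(c), while [M 1 0] is divisible by c pi^(l+m) for every m,
    hence zero. *)
Lemma hom_Dk_shift M : M \in unitmx ->
  (exists k l, forall m, hom (M *m Dk (k + m)) (Dk (l + m))) <-> M 1 0 = 0.
Proof.
rewrite unitmx_det => dM; split=> [[k [l klP]]|M10].
  apply: vge_all => n.
  suff [d dP] : exists d : int, forall m : nat, vge (m%:Z - d) (M 1 0).
    by apply: vgeW (dP (`|n| + `|d|)%N); lia.
  exists (`|v (\det M)| + k%:Z + l%:Z) => m.
  have [c [N [c0 [N0 dN vN] E]]] := klP m.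
  have dE : \det M * pi ^+ (k + m) = c ^+ 2 * (pi ^+ (l + m) * \det N).
    by rewrite -!det_Dk -!det_mulmx E detZ.
  have vE := congr1 v dE.
  rewrite !vM ?mulf_neq0 ?expf_neq0 // vN !vpik ?vX // in vE.
  have : (M *m Dk (k + m)) 1 0 = c * (Dk (l + m) *m N) 1 0 by rewrite E mxE.
  rewrite !mulmx2 !mx2E !(mul1r, mulr1, mul0r, mulr0, addr0, add0r) => ->.
  have cv : vge (v c) c by right.
  have piv : vge (l + m)%N%:Z (pi ^+ (l + m)) by right; rewrite vpik.
  by apply: vgeW (vgeM cv (vgeM piv (N0 1 0))); lia.
move: dM; rewrite det2 M10 mulr0 subr0 mulf_eq0 negb_or => /andP [a0 d0].
set a := M 0 0 in a0; set d := M 1 1 in d0; set b := M 0 1.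
(* [k] is large enough to make b pi^(k+m) / a integral and [l] nonnegative; the value of [l] makes
   the lower right entry of the witness a unit. *)
pose k := (`|v a| + `|v d| + `|v (b)|)%N.
pose l : nat := absz (k%:Z - v a + v d).
exists k, l => m.
have vlk : l%:Z = k%:Z - v a + v d by rewrite /l /k; lia.
exists a, (mx2 1 (b * pi ^+ (k + m) / a) 0 (d * pi ^+ (k + m) / pi ^+ (l + m) / a)).
have D0 : d * pi ^+ (k + m) / pi ^+ (l + m) / a != 0.
  by rewrite !mulf_neq0 ?invr_eq0 ?expf_neq0.
have vD0 : v (d * pi ^+ (k + m) / pi ^+ (l + m) / a) = 0.
  rewrite !vM ?mulf_neq0 ?invr_eq0 ?expf_neq0 // !vV ?expf_neq0 // !vpik; lia.
split=> //.
  split; rewrite ?det_mx2 ?mul1r ?mulr0 ?subr0 //.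
  apply: mge_mx2 => //; [exact: vge1| |by right; rewrite vD0].
  have [->|b0] := eqVneq (b) 0; first by rewrite !mul0r.
  right; rewrite !vM ?mulf_neq0 ?invr_eq0 ?expf_neq0 // vV // vpik /k; lia.
apply: mx2P; rewrite [RHS]mxE !mulmx2 !mx2E ?M10 -/a -/b -/d; clear D0 vD0 vlk;
  move: (pik0 (k + m)) (pik0 (l + m)); move: (pi ^+ _) (pi ^+ _) => s t s0 t0; field.
all: by rewrite ?a0 ?t0.
Qed.

(** The identification of ends with points of the projective line over K: [u] spans the line
    attached to the end of [rr]. *)
Definition ray_line rr (u : 'cV[K]_2) := exists P,
  [/\ P \in unitmx, forall k, hom (rr k) (P *m Dk k) & u = col 0 P].

Lemma ray_has_line rr : ray v rr -> exists2 u, u != 0 & ray_line rr u.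
Proof.
move=> /ray_normal_form [P Pu hP]; exists (col 0 P); last by exists P.
apply: contraTneq Pu => P0; rewrite unitmx_det det2 negbK.
have e i : P i 0 = 0 by have := congr1 (fun w : 'cV_2 => w i 0) P0; rewrite !mxE.
by rewrite !e mul0r mulr0 subr0.
Qed.

(** In the bases [P1] and [P2] the map [g] becomes a matrix M, and both sides amount to
    [M 1 0 = 0]. *)
Lemma ray_equiv_line r1 r2 u1 u2 g : ray v r1 -> ray v r2 -> g \in unitmx ->
  ray_line r1 u1 -> ray_line r2 u2 ->
  ray_equiv v (act_ray g r1) r2 <-> collinear (g *m u1) u2.
Proof.
move=> ray1 ray2 gu [P1 [P1u hP1 ->]] [P2 [P2u hP2 ->]].
have [M gP] : exists M, g *m P1 = P2 *m M.
  by exists (invmx P2 *m (g *m P1)); rewrite mulKVmx.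
have Mu : M \in unitmx.
  have : g *m P1 \in unitmx by rewrite unitmx_mul gu.
  by rewrite gP unitmx_mul => /andP [].
have M10E : collinear (g *m col 0 P1) (col 0 P2) <-> M 1 0 = 0.
  rewrite !colE mulmxA gP -mulmxA; split=> [[a E]|M10].
    have {}E : M *m delta_mx 0 0 = a *: delta_mx 0 (0 : 'I_1).
      by apply: (can_inj (mulKmx P2u)); rewrite E -scalemxAr.
    have := congr1 (fun w : 'cV_2 => w 1 0) E.
    by rewrite -colE !mxE /= mulr0.
  exists (M 0 0); rewrite scalemxAr; congr (_ *m _).
  by apply: cV2P; rewrite mulmx2 !mxE /= ?M10 !(mulr1, mulr0, addr0).
apply: iff_trans (iff_trans _ (hom_Dk_shift Mu)) (iff_sym M10E).
have homE k l : homothetic v (act_ray g r1 k) (r2 l) <-> hom (M *m Dk k) (Dk l).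
  have r1u := ray_unit k ray1; have r2u := ray_unit l ray2.
  apply: iff_trans (homotheticE _ r2u) _; first by rewrite unitmx_mul gu.
  have h1 : hom (g *m r1 k) (P2 *m (M *m Dk k)).
    by rewrite mulmxA -gP -mulmxA; apply: hom_mull.
  split=> [h|h].
    apply: (hom_mull_cancel P2u); apply: hom_trans (hom_sym h1) _.
    exact: hom_trans h (hP2 l).
  apply: hom_trans h1 _; apply: hom_trans (hom_mull P2 h) _.
  exact/hom_sym/hP2.
by split=> [[k [l E]]|[k [l E]]]; exists k, l => m; apply/homE.
Qed.

Lemma Dk_ray P : P \in unitmx -> ray v (fun k => P *m Dk k).
Proof.
move=> Pu k.
have PDu m : P *m Dk m \in unitmx by rewrite unitmx_mul Pu Dk_unit.
have D1 : mge 0 (Dk 1) by apply: mge_mx2 => //; [apply: vge1|right; rewrite vpik].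
have E1 : P *m Dk k.+1 = P *m Dk k *m Dk 1 by rewrite -(addn1 k) DkD mulmxA.
have nGO : ~ GO (Dk 1) by case=> _ _; rewrite det_Dk vpik.
have lat_neq A B M : A \in unitmx -> M \in unitmx -> B = A *m M -> ~ GO M -> mge 0 M ->
    set_psubP (lat v B) (lat v A).
  move=> Au Mu -> nM M0; split=> [|eqAB]; first exact: lat_sub.
  have [|M' M0' AE] := @lat_subE (A *m M) A _ (fun w Aw => (eqAB w).2 Aw).
    by rewrite unitmx_mul Au.
  apply: nM; have [] // := GO_of_mul M0 M0'.
  by rewrite -[M *m M'](mulKmx Au) !(mulmxA A) -AE mulVmx.
split=> //.
  exists pi, 1; split=> //; first exact: oner_neq0.
    rewrite scale1r; apply: (lat_neq _ _ (mx2 pi 0 0 1)) => //.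
    - by rewrite unitmx_det det_mx2 mulr1 mul0r subr0.
    - rewrite E1 -(mulmxA _ (Dk 1)) -mul_mx_scalar; congr (_ *m _).
      by apply: mx2P; rewrite mulmx2 !mx2E [LHS]mxE /= ?expr1 ?mulr1n ?mulr0n; ring.
    - by case=> _ _; rewrite det_mx2 mulr1 mul0r subr0 vpi.
    - by apply: mge_mx2 => //; [right; rewrite vpi|apply: vge1].
  by rewrite scale1r; apply: lat_neq (Dk_unit 1) E1 nGO D1.
(* Backtracking would give Dk 2 = c N with N in GL_2(O): the upper left entry forces v(c) <= 0, the
   determinant v(c) = 1. *)
move/(homotheticE (PDu _) (PDu _)); rewrite -(addn2 k) DkD mulmxA.
move/hom_sym=> [c [N [c0 [N0 dN vN] E]]].
have {E} E : Dk 2 = c *: N.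
  by apply: (can_inj (mulKmx (PDu k))); rewrite E -scalemxAr.
have N00 : c * N 0 0 = 1 by have := congr1 (fun A : 'M_2 => A 0 0) E; rewrite !mxE /= => <-.
have : vge 0 (c^-1) by have -> : c^-1 = N 0 0; [by rewrite -[RHS](mulKf c0) N00 mulr1|apply: N0].
move=> /vgeE; rewrite invr_eq0 vV // => /(_ c0) vc.
have := congr1 (fun A => v (\det A)) E; rewrite det_Dk vpik detZ vM ?expf_neq0 // vX // vN.
have N11 : c * N 1 1 = pi ^+ 2 by have := congr1 (fun A : 'M_2 => A 1 1) E; rewrite !mxE /= => <-.
lia.
Qed.

End Rays.

(** * Lines in the plane and pairs of lines *)

Definition colpair (u w : 'cV[K]_2) : 'M[K]_2 := mx2 (u 0 0) (w 0 0) (u 1 0) (w 1 0).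

Lemma colpair_unit u w : (colpair u w \in unitmx) = (om u w != 0).
Proof. by rewrite unitmx_det det_mx2 /om mulrC [w 0 0 * _]mulrC [_ * u 0 0]mulrC. Qed.

Lemma col0_colpair u w : col 0 (colpair u w) = u.
Proof. by apply: cV2P; rewrite !mxE. Qed.

Lemma mul_colpair A u w a b c d : A *m u = a *: u + c *: w -> A *m w = b *: u + d *: w ->
  A *m colpair u w = colpair u w *m mx2 a b c d.
Proof.
move=> Au Aw.
have e (x y : 'cV[K]_2) i : A *m x = y -> A i 0 * x 0 0 + A i 1 * x 1 0 = y i 0.
  by move <-; rewrite mulmx2.
by apply: mx2P; rewrite !mulmx2 !mx2E ?(e _ _ _ Au) ?(e _ _ _ Aw) !mxE; ring.
Qed.

Lemma omC (u w : 'cV[K]_2) : om w u = - om u w.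
Proof. by rewrite /om; ring. Qed.

Lemma om_ne0l (u w : 'cV[K]_2) : om u w != 0 -> u != 0.
Proof. by apply: contraNneq => ->; rewrite /om !mxE !mul0r subrr. Qed.

Lemma om_ne0r (u w : 'cV[K]_2) : om u w != 0 -> w != 0.
Proof. by rewrite -oppr_eq0 -omC; apply: om_ne0l. Qed.

Lemma collinear_om (u w : 'cV[K]_2) : collinear u w -> om u w = 0.
Proof. by move=> [a ->]; rewrite /om !mxE; ring. Qed.

Lemma om_exists (u : 'cV[K]_2) : u != 0 -> exists w, om u w != 0.
Proof.
move=> u0; apply: NNPP => no.
have om0 w : om u w = 0 by apply/eqP/negPn/negP => ?; apply: no; exists w.
case/eqP: u0; apply: cV2P; rewrite mxE.
  by have := om0 (delta_mx 1 0); rewrite /om !mxE /= mulr1 mulr0 subr0.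
have := om0 (delta_mx 0 0); rewrite /om !mxE /= mulr1 mulr0 sub0r.
by move/eqP; rewrite oppr_eq0 => /eqP.
Qed.

Lemma om_basis (u w x : 'cV[K]_2) : om u w != 0 -> exists a b, x = a *: u + b *: w.
Proof.
move=> uw; exists (om x w / om u w), (om u x / om u w).
by apply: cV2P; rewrite !mxE; move: uw; rewrite /om => uw; field.
Qed.

Lemma collinear_mul A B (u w z : 'cV[K]_2) : collinear (B *m u) w ->
  collinear (A *m w) z -> collinear (A *m B *m u) z.
Proof.
by move=> [a Bu] [b Aw]; exists (a * b); rewrite -mulmxA Bu -scalemxAr Aw scalerA.
Qed.

Lemma collinear_inv A (u w : 'cV[K]_2) : A \in unitmx -> u != 0 ->
  collinear (A *m u) w -> collinear (invmx A *m w) u.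
Proof.
move=> Au u0 [a Auw]; exists a^-1.
have a0 : a != 0.
  apply: contraNneq u0 => a0; rewrite -[u](mulKmx Au) Auw a0 scale0r.
  by rewrite mulmx0.
by apply: (scalerI a0); rewrite scalerA mulfV // scale1r scalemxAr -Auw mulKmx.
Qed.

Definition permutes_lines A (u w : 'cV[K]_2) :=
  (collinear (A *m u) u /\ collinear (A *m w) w) \/
  (collinear (A *m u) w /\ collinear (A *m w) u).

Lemma permutes_lines_mul A B u w : permutes_lines A u w -> permutes_lines B u w ->
  permutes_lines (A *m B) u w.
Proof.
case=> [[Au Aw]|[Au Aw]]; case=> [[Bu Bw]|[Bu Bw]].
- by left; split; [apply: collinear_mul Bu Au|apply: collinear_mul Bw Aw].
- by right; split; [apply: collinear_mul Bu Aw|apply: collinear_mul Bw Au].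
- by right; split; [apply: collinear_mul Bu Au|apply: collinear_mul Bw Aw].
- by left; split; [apply: collinear_mul Bu Aw|apply: collinear_mul Bw Au].
Qed.

Lemma permutes_lines_inv A u w : A \in unitmx -> u != 0 -> w != 0 ->
  permutes_lines A u w -> permutes_lines (invmx A) u w.
Proof.
move=> Au u0 w0 [[? ?]|[? ?]]; first by left; split; apply: collinear_inv.
by right; split; apply: collinear_inv.
Qed.

(** * Elementary groups in terms of invariant lines and integral conjugates *)

Section Stabilizers.
Variable G : 'M[K]_2 -> Prop.
Hypothesis GU : forall A, G A -> A \in unitmx.

Lemma line_ray pi (u : 'cV[K]_2) : pi != 0 -> v pi = 1 -> u != 0 ->
  exists2 rr, ray v rr & ray_line pi rr u.
Proof.
move=> pi0 vpi u0; have [w uw] := om_exists u0.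
have Pu : colpair u w \in unitmx by rewrite colpair_unit.
exists (fun k => colpair u w *m Dk pi k); first exact: Dk_ray.
by exists (colpair u w); split; [|move=> k; apply: hom_refl|rewrite col0_colpair].
Qed.

Lemma stab_end_of_line (u : 'cV[K]_2) : u != 0 ->
  (forall A, G A -> collinear (A *m u) u) -> stab_end v G.
Proof.
have [pi [pi0 vpi]] := uniformizer.
move=> u0 Gu; have [rr rayr rru] := line_ray pi0 vpi u0.
by exists rr; split=> // A GA; apply/(ray_equiv_line pi0 vpi rayr rayr (GU GA) rru rru); apply: Gu.
Qed.

Lemma line_of_stab_end : stab_end v G ->
  exists2 u, u != 0 & forall A, G A -> collinear (A *m u) u.
Proof.
have [pi [pi0 vpi]] := uniformizer.
move=> [rr [rayr Gr]]; have [u u0 ru] := ray_has_line pi0 vpi rayr.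
exists u => // A GA.
by apply/(ray_equiv_line pi0 vpi rayr rayr (GU GA) ru ru); apply: Gr.
Qed.

Lemma ray_equiv_act1 r1 r2 : ray_equiv v (act_ray 1%:M r1) r2 <-> ray_equiv v r1 r2.
Proof.
by split=> [[k [l E]]|[k [l E]]]; exists k, l => m; have := E m; rewrite /act_ray mul1mx.
Qed.

Lemma stab_pair_of_lines (u w : 'cV[K]_2) : om u w != 0 ->
  (forall A, G A -> permutes_lines A u w) -> stab_pair_ends v G.
Proof.
have [pi [pi0 vpi]] := uniformizer.
move=> uw Guw; have u0 := om_ne0l uw; have w0 := om_ne0r uw.
have [r1 ray1 r1u] := line_ray pi0 vpi u0.
have [r2 ray2 r2w] := line_ray pi0 vpi w0.
exists r1, r2; split=> //.
  move/ray_equiv_act1/(ray_equiv_line pi0 vpi ray1 ray2 (unitmx1 _ _) r1u r2w).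
  by rewrite mul1mx => /collinear_om /eqP; rewrite (negPf uw).
move=> A GA; have Au := GU GA.
case: (Guw A GA) => [[Auu Aww]|[Auw Awu]]; [left|right]; split.
- by apply/(ray_equiv_line pi0 vpi ray1 ray1 Au r1u r1u).
- by apply/(ray_equiv_line pi0 vpi ray2 ray2 Au r2w r2w).
- by apply/(ray_equiv_line pi0 vpi ray1 ray2 Au r1u r2w).
- by apply/(ray_equiv_line pi0 vpi ray2 ray1 Au r2w r1u).
Qed.

Lemma lines_of_stab_pair : stab_pair_ends v G -> exists u w, om u w != 0 /\
  forall A, G A -> permutes_lines A u w.
Proof.
have [pi [pi0 vpi]] := uniformizer.
move=> [r1 [r2 [ray1 ray2 neq Gr]]].
have [u u0 r1u] := ray_has_line pi0 vpi ray1.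
have [w w0 r2w] := ray_has_line pi0 vpi ray2.
exists u, w; split.
  apply/eqP => uw; apply: neq.
  apply/ray_equiv_act1/(ray_equiv_line pi0 vpi ray1 ray2 (unitmx1 _ _) r1u r2w).
  by rewrite mul1mx; apply: om_collinear.
move=> A GA; have Au := GU GA.
case: (Gr A GA) => [[A1 A2]|[A1 A2]]; [left|right]; split.
- by apply/(ray_equiv_line pi0 vpi ray1 ray1 Au r1u r1u).
- by apply/(ray_equiv_line pi0 vpi ray2 ray2 Au r2w r2w).
- by apply/(ray_equiv_line pi0 vpi ray1 ray2 Au r1u r2w).
- by apply/(ray_equiv_line pi0 vpi ray2 ray1 Au r2w r1u).
Qed.

(** Determinant 1 forces the homothety factor to be a unit. *)
Lemma integral_of_stab_vertex : (forall A, G A -> SL2 A) -> stab_vertex v G ->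
  exists2 P, P \in unitmx & forall A, G A -> mge 0 (invmx P *m A *m P).
Proof.
move=> G1 [P [Pu GP]]; exists P => // A GA.
have Au := GU GA.
have /homotheticE [|//|c [N [c0 [N0 dN vN] E]]] := GP A GA.
  by rewrite unitmx_mul Au.
have XE : invmx P *m A *m P = c *: N.
  by rewrite -mulmxA E -scalemxAr mulKmx.
have : \det (invmx P *m A *m P) = 1.
  by rewrite !det_mulmx (G1 _ GA) mulr1 -det_mulmx mulVmx // det1.
rewrite XE detZ => /(congr1 v); rewrite vM ?expf_neq0 // vX // vN v1 => vc.
by rewrite -[0]/(0 + 0 : int); apply: mgeZ => //; right; lia.
Qed.

End Stabilizers.

Lemma stab_vertex_of_integral r (h : 'I_r -> 'M[K]_2) P : (forall i, SL2 (h i)) ->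
  P \in unitmx -> (forall i, mge 0 (invmx P *m h i *m P)) -> stab_vertex v (gen h).
Proof.
move=> h1 Pu hP; exists P; split=> // A hA.
have Au := SL2_unit (gen_SL2 h1 hA).
apply/homotheticE => //; first by rewrite unitmx_mul Au.
have A0 : mge 0 (invmx P *m A *m P).
  have conjM B C : invmx P *m (B *m C) *m P = (invmx P *m B *m P) *m (invmx P *m C *m P).
    by rewrite -!mulmxA mulKVmx.
  move: A hA {Au}; apply: gen_ind => //.
  - by rewrite mulmx1 mulVmx //; apply: mge1.
  - by move=> i A _ A0; rewrite conjM; exact: mge_mul0 (hP i) A0.
  - move=> i A _ A0; rewrite conjM; apply: mge_mul0 A0.
    have -> : invmx P *m invmx (h i) *m P = adj2 (invmx P *m h i *m P).
      have X1 : SL2 (invmx P *m h i *m P).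
        by rewrite /SL2 !det_mulmx h1 mulr1 -det_mulmx mulVmx // det1.
      rewrite -SL2_inv //; apply: (can_inj (mulKmx (SL2_unit X1))).
      by rewrite -conjM (mulmxV (SL2_unit (h1 i))) mulmx1 mulVmx // (mulmxV (SL2_unit X1)).
    exact: mge_adj2.
exists 1, (invmx P *m A *m P); split; first exact: oner_neq0.
  have dX : \det (invmx P *m A *m P) = 1.
    by rewrite !det_mulmx (gen_SL2 h1 hA) mulr1 -det_mulmx mulVmx // det1.
  by split; rewrite ?dX ?oner_neq0 ?v1.
by rewrite scale1r -mulmxA mulKVmx.
Qed.

(** * Elementary limits *)

Lemma singular_kernel A : \det A = 0 -> exists2 u : 'cV[K]_2, u != 0 & A *m u = 0.
Proof.
move=> dA; have dAT : \det A^T = 0 by rewrite det_tr.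
have /eqP/det0P [w w0 wA] := dAT.
exists w^T; first by rewrite trmx_eq0.
by apply: trmx_inj; rewrite trmx_mul trmxK wA trmx0.
Qed.

Section Hyperbolic.
Variable H : 'M[K]_2.
Hypotheses (H1 : SL2 H) (tr0 : \tr H != 0) (vtr : v (\tr H) < 0).

Lemma hyperbolic_eigenvalue : exists l, [/\ l != 0, l ^+ 2 != 1 & \tr H = l + l^-1].
Proof.
have [l lP] := quadratic_root tr0 vtr.
have l0 : l != 0.
  by apply: contra_eq_neq lP => ->; rewrite mulr0 subr0 expr0n add0r oner_neq0.
have trE : \tr H = l + l^-1.
  apply: (mulIf l0); rewrite mulrDl mulVf //.
  by apply/eqP; rewrite -subr_eq0 -oppr_eq0 -lP; apply/eqP; ring.
exists l; split=> //; apply/eqP => l2.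
have lV : l^-1 = l by apply: (mulfI l0); rewrite mulfV // -l2.
have vl : v l = 0 by have := congr1 v l2; rewrite vX // v1; lia.
have : vge 0 (\tr H) by rewrite trE lV; apply: vgeD; right; rewrite vl.
by move/(vgeE tr0); lia.
Qed.

Lemma eigenvector l : l != 0 -> \tr H = l + l^-1 ->
  exists2 u : 'cV[K]_2, u != 0 & H *m u = l *: u.
Proof.
move=> l0 trE; have [|u u0 Hu] := @singular_kernel (H - l%:M).
  have dE : \det (H - l%:M) = l ^+ 2 - \tr H * l + \det H.
    by rewrite !det2 tr2 !mxE /= ?mulr1n ?mulr0n; ring.
  by rewrite dE trE H1; field.
exists u => //; apply/eqP; rewrite -subr_eq0 -Hu mulmxBl mul_scalar_mx.
by [].
Qed.

Lemma eigenspace_line l (u w : 'cV[K]_2) : l ^+ 2 != 1 -> H *m u = l *: u -> u != 0 ->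
  H *m w = l *: w -> collinear w u.
Proof.
move=> l2 Hu u0 Hw; apply: om_collinear => //.
have := SL2_om w u H1; rewrite Hu Hw => E.
have : (l ^+ 2 - 1) * om w u = 0 by rewrite mulrBl mul1r -{2}E /om !mxE; ring.
by move/eqP; rewrite mulf_eq0 subr_eq0 (negPf l2) => /eqP.
Qed.

(** The hypothesis on [A] says that A^-1 H A commutes with H, hence preserves each eigenline of H;
    so A maps eigenlines of H to eigenlines of H, and there are only two. *)
Lemma hyperbolic_axis : exists u w, om u w != 0 /\
  forall A, SL2 A -> A *m H *m invmx A *m H = H *m (A *m H *m invmx A) ->
  permutes_lines A u w.
Proof.
have [l [l0 l2 trE]] := hyperbolic_eigenvalue.
have l'0 : l^-1 != 0 by rewrite invr_eq0.
have l'2 : l^-1 ^+ 2 != 1 by rewrite exprVn invr_eq1.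
have [u u0 Hu] := eigenvector l0 trE.
have [|w w0 Hw] := @eigenvector l^-1 l'0; first by rewrite invrK addrC.
have uw : om u w != 0.
  apply/eqP => /(om_collinear w0) [a uE].
  have : l *: u = l^-1 *: u by rewrite -Hu uE -scalemxAr Hw !scalerA mulrC.
  move/eqP; rewrite -subr_eq0 -scalerBl scaler_eq0 (negPf u0) orbF subr_eq0 => /eqP lV.
  by case/eqP: l2; rewrite expr2 {2}lV mulfV.
exists u, w; split=> // A A1 HA; have Au := SL2_unit A1.
have eigen_line m (z : 'cV[K]_2) : z != 0 -> H *m z = m *: z -> collinear z u \/ collinear z w.
  move=> z0 Hz; have : H *m H *m z = \tr H *: (H *m z) - z.
    by rewrite Cayley_Hamilton2 H1 mulmxBl mul1mx scalemxAl.
  rewrite -mulmxA Hz -scalemxAr Hz !scalerA trE => E.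
  have : ((m - l) * (m - l^-1)) *: z = 0.
    have -> : (m - l) * (m - l^-1) = m * m - ((l + l^-1) * m - 1) by field.
    by rewrite scalerBl E scalerBl scale1r subrr.
  move/eqP; rewrite scaler_eq0 (negPf z0) orbF mulf_eq0 !subr_eq0.
  by move=> /orP [/eqP mE|/eqP mE]; rewrite mE in Hz; [left|right];
    apply: eigenspace_line Hz.
pose H' := invmx A *m H *m A.
have H'H : H' *m H = H *m H'.
  have := congr1 (fun X => invmx A *m X *m A) HA.
  by rewrite !mulmxA !(mulVmx Au) !mul1mx -!mulmxA !(mulVmx Au) !mulmx1 !mulmxA /H' => <-.
have image_line m (z : 'cV[K]_2) : m ^+ 2 != 1 -> z != 0 -> H *m z = m *: z ->
    collinear (A *m z) u \/ collinear (A *m z) w.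
  move=> m2 z0 Hz.
  have [|a H'z] := @eigenspace_line m z (H' *m z) m2 Hz z0.
    by rewrite mulmxA -H'H -mulmxA Hz -scalemxAr.
  apply: (eigen_line a).
    by apply: contraNneq z0 => Az; rewrite -[z](mulKmx Au) Az mulmx0.
  by rewrite scalemxAr -H'z /H' !mulmxA mulmxV // mul1mx.
have distinct (z : 'cV[K]_2) : collinear (A *m u) z -> collinear (A *m w) z -> False.
  move=> [a Az] [b Az']; have := SL2_om u w A1; rewrite Az Az' => E.
  by case/eqP: uw; rewrite -E /om !mxE; ring.
have [Auu|Auw] := image_line l u l2 u0 Hu; have [Awu|Aww] := image_line l^-1 w l'2 w0 Hw.
- by case: (distinct u).
- by left.
- by right.
- by case: (distinct w).
Qed.

End Hyperbolic.

Lemma v_add_inv_lt0 a : a != 0 -> v a != 0 -> a + a^-1 != 0 /\ v (a + a^-1) < 0.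
Proof.
wlog: a / 0 < v a => [W a0 va|va a0 _].
  have [|va'] := ltP 0 (v a); first by move=> ?; apply: W.
  rewrite addrC -{2 4}[a]invrK; apply: W; rewrite ?invr_eq0 // vV //; lia.
have [||s0 ->] := @v_close a^-1 (a + a^-1).
- by rewrite invr_eq0.
- by rewrite addrK vV //; right; lia.
by rewrite vV //; split=> //; lia.
Qed.

Lemma conj_SL2_det P A X : P \in unitmx -> SL2 A -> A *m P = P *m X -> SL2 X.
Proof.
rewrite unitmx_det /SL2 => P0 A1 E; apply: (mulfI P0).
by rewrite -det_mulmx -E det_mulmx A1 mulr1 mul1r.
Qed.

Section LimitElementary.
Variables (r : nat) (gn : nat -> 'I_r -> 'M[K]_2) (g : 'I_r -> 'M[K]_2) (N : int).
Hypotheses (gn1 : forall n i, SL2 (gn n i)) (g1 : forall i, SL2 (g i)).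
Hypothesis gn_g : forall i, mlim (fun n => gn n i) (g i).
Hypothesis gn_iso : eventually (fun n => isolated1 (gn n) N).

(** For large n the conjugated generators differ from integral matrices by integral matrices, so
    they are integral themselves. *)
Lemma ev_stab_vertex P : P \in unitmx -> (forall i, mge 0 (invmx P *m g i *m P)) ->
  eventually (fun n => stab_vertex v (gen (gn n))).
Proof.
move=> Pu Pg.
have lim_conj i : mlim (fun n => invmx P *m gn n i *m P) (invmx P *m g i *m P).
  by apply: mlim_mul (mlim_cst P); apply: mlim_mul (mlim_cst _) (gn_g i).
apply: ev_mono (ev_fin (fun i => lim_conj i 0)) => n nP.
apply: (stab_vertex_of_integral (gn1 n) Pu) => i.
by rewrite -[X in mge 0 X](subrK (invmx P *m g i *m P)); apply: mgeD.
Qed.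

(** When invertible, these normalise the diagonal torus: conjugates of a diagonal matrix stay
    diagonal, hence commute with it. *)
Definition monomial A := (A 0 1 = 0 /\ A 1 0 = 0) \/ (A 0 0 = 0 /\ A 1 1 = 0).

(* a word w diagonal and hyperbolic in a basis where the generators are monomial stays
   hyperbolic nearby, and its commutation with its conjugates is a finite set of relations *)
Lemma ev_stab_pair P w a : P \in unitmx -> a != 0 -> v a != 0 ->
  eval_word g w *m P = P *m mx2 a 0 0 a^-1 ->
  (forall i, exists2 X, monomial X & g i *m P = P *m X) ->
  eventually (fun n => stab_pair_ends v (gen (gn n))).
Proof.
move=> Pu a0 va HP gP; set H := eval_word g w in HP.
have H1 : SL2 H by apply: eval_SL2.
have HE : H = P *m mx2 a 0 0 a^-1 *m invmx P by rewrite -HP mulmxK.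
have trH : \tr H = a + a^-1 by rewrite HE mxtrace_mulC mulmxA mulVmx // mul1mx tr2 !mx2E.
have [t0 vt] := v_add_inv_lt0 a0 va; rewrite -trH in t0 vt.
(* The relation states that H commutes with its conjugate by [g i]; in the basis [P] both are
   diagonal. *)
have rel i : eval_word g ((i, false) :: w ++ (i, true) :: w) =
             eval_word g (w ++ (i, false) :: w ++ [:: (i, true)]).
  rewrite /= !eval_cat /= !eval_cat /= mulmx1 /letter /= -/H.
  have [X Xm gX] := gP i.
  have X1 := conj_SL2_det Pu (g1 i) gX; have Xu := SL2_unit X1.
  have gE : g i = P *m X *m invmx P by rewrite -gX mulmxK.
  have g'E : invmx (g i) = P *m invmx X *m invmx P.
    apply: (can_inj (mulKmx (SL2_unit (g1 i)))); rewrite mulmxV ?SL2_unit // gE.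
    by rewrite !mulmxA mulmxKV // mulmxK // mulmxV.
  have cancelP (A B : 'M[K]_2) : P *m A *m invmx P *m (P *m B *m invmx P) =
      P *m (A *m B) *m invmx P.
    by rewrite !mulmxA mulmxKV.
  rewrite g'E gE HE !cancelP SL2_inv //; congr (_ *m _ *m _).
  move: X1; rewrite /SL2 det2 => X1.
  by case: Xm => [[X01 X10]|[X00 X11]]; apply: mx2P; rewrite !mulmx2 !mx2E;
    rewrite ?X01 ?X10 ?X00 ?X11; ring.
have ev_rel := ev_fin (fun i => ev_eval_eq gn1 g1 gn_g gn_iso (rel i)).
have ev_tr := mlim_eval gn1 g1 gn_g w 0.
apply: ev_mono (ev_and ev_rel ev_tr) => n [nrel ntr].
set Hn := eval_word (gn n) w in ntr.
have Hn1 : SL2 Hn by apply: eval_SL2.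
(* The trace of H has negative valuation, which an integral error does not change. *)
have [tn0 vtn] : \tr Hn != 0 /\ v (\tr Hn) < 0.
  have [] := @v_close (\tr H) (\tr Hn) t0; last by move=> -> ->.
  apply: (@vgeW 0); first lia.
  have -> : \tr Hn - \tr H = \tr (Hn - H) by rewrite raddfB.
  by rewrite tr2; apply: vgeD; apply: ntr.
have [u [z [uz Huz]]] := hyperbolic_axis Hn1 tn0 vtn.
apply: (stab_pair_of_lines (fun A hA => SL2_unit (gen_SL2 (gn1 n) hA)) uz).
have u0 := om_ne0l uz; have z0 := om_ne0r uz.
have gen_perm i : permutes_lines (gn n i) u z.
  apply: Huz => //; have := nrel i.
  rewrite /= !eval_cat /= !eval_cat /= mulmx1 /letter /= -/Hn => E.
  by rewrite -!mulmxA.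
apply: gen_ind => //.
- by left; split; exists 1; rewrite mul1mx scale1r.
- by move=> i A _; apply: permutes_lines_mul.
- move=> i A _; apply: permutes_lines_mul; apply: permutes_lines_inv => //.
  exact/SL2_unit.
Qed.


(* conjugating by powers of H contracts the unipotent part of A, so by discreteness
   that part vanishes *)
Lemma contracted_unipotent_trivial H A P a x y z : gen g H -> gen g A ->
  P \in unitmx -> a != 0 -> 0 < v a -> H *m P = P *m mx2 a 0 0 a^-1 ->
  A *m P = P *m mx2 x y 0 z -> y = 0.
Proof.
move=> gH gA Pu a0 va HP AP; have iso := limit_isolated1 gn1 g1 gn_g gn_iso.
have am0 m : a ^+ m != 0 by rewrite expf_neq0.
have HmP m : (H ^+ m) *m P = P *m mx2 (a ^+ m) 0 0 (a ^- m).
  elim: m => [|m IHm].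
    rewrite expr0 mul1mx -[LHS]mulmx1; congr (_ *m _).
    by apply: mx2P; rewrite mx2E !mxE //= ?expr0 ?invr1.
  rewrite exprSr -[_ * H *m P]mulmxA HP mulmxA IHm -mulmxA; congr (_ *m _).
  by apply: mx2P; rewrite mulmx2 !mx2E ?exprSr ?invfM; ring.
pose E m := H ^+ m *m A *m invmx (H ^+ m).
pose Y m := mx2 x (a ^+ m ^+ 2 * y) 0 z.
have Hmu m : H ^+ m \in unitmx by apply/SL2_unit/(gen_SL2 g1)/gen_exp.
have HVP m : invmx (H ^+ m) *m P = P *m mx2 (a ^- m) 0 0 (a ^+ m).
  apply: (can_inj (mulKmx (Hmu m))); rewrite mulKVmx // mulmxA HmP -mulmxA.
  rewrite -[LHS]mulmx1; congr (_ *m _).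
  by apply: mx2P; rewrite mulmx2 !mx2E !mxE /=; field.
have EP m : E m = P *m Y m *m invmx P.
  apply: (can_inj (mulmxK Pu)); rewrite mulmxKV // -!mulmxA HVP.
  rewrite !mulmxA -(mulmxA _ A) AP !mulmxA HmP -!mulmxA; congr (_ *m _).
  by apply: mx2P; rewrite !mulmx2 !mx2E; field.
have gE m : gen g (E m).
  by apply: gen_mul; [apply: gen_mul => //|apply: gen_inv => //]; apply: gen_exp.
have [p pP] := mge_bound P; have [p' p'P] := mge_bound (invmx P).
have [e eY] := mge_bound (mx2 x y 0 z).
have [ex [ey [e0 ez]]] : vge (- e%:Z) x /\ vge (- e%:Z) y /\ vge (- e%:Z) 0 /\ vge (- e%:Z) z.
  by have := (eY 0 0, eY 0 1, eY 1 0, eY 1 1); rewrite !mx2E => -[[[]]].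
have a1 : vge 1 a by right; lia.
have amO m : vge m%:Z (a ^+ m ^+ 2).
  by rewrite -exprM; apply: vgeW (vgeX _ a1); lia.
(* [c] bounds every conjugate [E m], and at this [m] two consecutive ones agree to precision N + c,
   so they coincide. Both lie in G, which need not be known of the limit of the sequence. *)
pose c := (p + e + p')%N; pose m := (`|N| + c + c)%N.
have cE : mge (- c%:Z) (E m).
  rewrite EP; have Ye : mge (- e%:Z) (Y m).
    apply: mge_mx2 => //; apply: vge_M0l => //.
    by apply: vgeW (amO m); lia.
  by apply: mgeW (mgeM (mgeM pP Ye) p'P); lia.
have dE : mge (N + c%:Z) (E m.+1 - E m).
  rewrite !EP -mulmxBl -mulmxBr.
  have dY : mge (m%:Z - e%:Z) (Y m.+1 - Y m).
    have -> : Y m.+1 - Y m = mx2 0 (a ^+ m ^+ 2 * ((a ^+ 2 - 1) * y)) 0 0.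
      by apply: mx2P; rewrite !mxE /= ?exprSr; ring.
    apply: mge_mx2 => //; apply: vgeM => //; apply: vge_M0l => //.
    apply: vgeB; last exact: vge1.
    by apply: vgeW (vgeX 2 a1); lia.
  by apply: mgeW (mgeM (mgeM pP dY) p'P); lia.
have := isolated1_eq g1 iso (gE m) (gE m.+1) cE dE.
rewrite !EP => /(can_inj (mulmxKV Pu)) /(can_inj (mulKmx Pu)).
move/(congr1 (fun M : 'M_2 => M 0 1)); rewrite !mx2E => Em.
have : a ^+ m ^+ 2 * ((a ^+ 2 - 1) * y) = 0.
  rewrite (_ : a ^+ m ^+ 2 * ((a ^+ 2 - 1) * y) = a ^+ m.+1 ^+ 2 * y - a ^+ m ^+ 2 * y).
    by rewrite Em subrr.
  by rewrite (exprSr a m); ring.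
move/eqP; rewrite mulf_eq0 !expf_eq0 /= (negPf a0) andbF /= mulf_eq0 subr_eq0.
case/orP => [/eqP a2|/eqP //].
by have := vX 2 a0; rewrite a2 v1; lia.
Qed.

Lemma ev_elementary_line (u : 'cV[K]_2) : u != 0 ->
  (forall i, collinear (g i *m u) u) -> eventually (fun n => elementary v (gen (gn n))).
Proof.
move=> u0 gu; have [pi [pi0 vpi]] := uniformizer.
have [w0 uw0] := om_exists u0.
have Pu : colpair u w0 \in unitmx by rewrite colpair_unit.
set P := colpair u w0 in Pu; have [X gX] : exists X, forall i, g i *m P = P *m X i.
  by exists (fun i => invmx P *m (g i *m P)) => i; rewrite mulKVmx.
have X10 i : X i 1 0 = 0.
  have [a gua] := gu i; have [b [d gw]] := om_basis (g i *m w0) uw0.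
  have gP : g i *m P = P *m mx2 a b 0 d by apply: mul_colpair; rewrite ?scale0r ?addr0.
  by rewrite (can_inj (mulKmx Pu) (etrans (esym (gX i)) gP)) mx2E.
have Xdet i : X i 0 0 * X i 1 1 = 1.
  by have := conj_SL2_det Pu (g1 i) (gX i); rewrite /SL2 det2 X10 mulr0 subr0.
have X00 i : X i 0 0 != 0.
  by apply/eqP => X0; have /eqP := Xdet i; rewrite X0 mul0r eq_sym oner_eq0.
have X11 i : X i 1 1 = (X i 0 0)^-1 by apply: (mulfI (X00 i)); rewrite Xdet mulfV.
have gua i : g i *m u = X i 0 0 *: u.
  have := congr1 (col 0) (gX i); rewrite !colE -!mulmxA -!colE col0_colpair => ->.
  by apply: cV2P; rewrite !mulmx2 !mxE /= X10; ring.
(* If all diagonal entries are units, shrinking the second basis vector makes every generator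
   integral; otherwise some generator is hyperbolic. *)
have [/forallP allv|] := boolP [forall i, v (X i 0 0) == 0].
  pose k := (\max_i `|v (X i 0%R 1%R)|)%N.
  have Qu : P *m Dk pi k \in unitmx by rewrite unitmx_mul Pu Dk_unit.
  apply: ev_mono (ev_stab_vertex Qu _) => [n|i]; first by left.
  have gQ : g i *m (P *m Dk pi k) =
      P *m Dk pi k *m mx2 (X i 0 0) (X i 0 1 * pi ^+ k) 0 (X i 1 1).
    rewrite mulmxA gX -!mulmxA; congr (_ *m _).
    by apply: mx2P; rewrite !mulmx2 !mx2E ?X10; ring.
  rewrite -mulmxA gQ mulKmx //; have /eqP vi := allv i.
  apply: mge_mx2 => //.
  - by right; rewrite vi.
  - have le_k : (`|v (X i 0%R 1%R)| <= k)%N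
      by apply: (leq_bigmax (F := fun i => `|v (X i 0%R 1%R)|%N)).
    have piv : vge k%:Z (pi ^+ k) by right; rewrite vpik.
    by apply: vgeW (vgeM (vge_refl (X i 0 1)) piv); lia.
  - by right; rewrite X11 vV // vi.
rewrite negb_forall => /existsP [j vj].
(* Passing to the inverse if necessary makes [v a] positive, the sign needed for the contraction. *)
have [l [a [a0 va Hu]]] : exists l a, [/\ a != 0, 0 < v a & letter g l *m u = a *: u].
  have [va|va] := ltP 0 (v (X j 0 0)).
    by exists (j, false), (X j 0 0); rewrite /letter /= gua.
  exists (j, true), (X j 0 0)^-1; rewrite invr_eq0 X00 vV //; split=> //; first lia.
  have gju := SL2_unit (g1 j); rewrite /letter /=.
  apply: (can_inj (mulKmx gju)); rewrite mulKVmx // -scalemxAr gua scalerA.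
  by rewrite mulVf // scale1r.
set H := letter g l in Hu; have H1 : SL2 H by apply: letter_SL2.
have [b [d Hw0]] := om_basis (H *m w0) uw0.
have dE : d = a^-1.
  apply: (mulfI a0); rewrite mulfV //; apply: (mulIf uw0); rewrite mul1r.
  by rewrite -[RHS](SL2_om _ _ H1) Hu Hw0 /om !mxE; ring.
have ad : a^-1 - a != 0.
  rewrite subr_eq0; apply/eqP => aV; have := vV a0; rewrite aV; lia.
(* The value of [y] for which [w0 + y *: u] is the second eigenvector of H. *)
pose y := b / (a^-1 - a); have yE : y * (a^-1 - a) = b by rewrite divfK.
pose w := w0 + y *: u.
have uw : om u w != 0 by rewrite (_ : om u w = om u w0) // /om !mxE; ring.
have Hw : H *m w = a^-1 *: w.
  rewrite /w mulmxDr -scalemxAr Hu Hw0 dE -yE; apply/matrixP => i' j'.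
  by rewrite !mxE; ring.
have Qu : colpair u w \in unitmx by rewrite colpair_unit.
have HQ : H *m colpair u w = colpair u w *m mx2 a 0 0 a^-1.
  by apply: mul_colpair; rewrite ?scale0r ?addr0 ?add0r.
have gH : gen g H by exists [:: l]; rewrite eval_letter.
have va0 : v a != 0 by apply/eqP; lia.
have HQ' : eval_word g [:: l] *m colpair u w = colpair u w *m mx2 a 0 0 a^-1.
  by rewrite eval_letter.
apply: ev_mono (ev_stab_pair Qu a0 va0 HQ' _) => [n|i]; first by right; right.
have [y' [z gw]] := om_basis (g i *m w) uw.
have giQ : g i *m colpair u w = colpair u w *m mx2 (X i 0 0) y' 0 z.
  by apply: mul_colpair; rewrite ?gua ?scale0r ?addr0.
have y'0 := contracted_unipotent_trivial gH (gen_gen g i) Qu a0 va HQ giQ.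
by exists (mx2 (X i 0 0) y' 0 z) => //; left; rewrite !mx2E y'0.
Qed.

(** A generator [g j] exchanging the lines serves to normalise the basis: with [w = g j *m u] its
    matrix is integral. A generator with nonintegral matrix then yields a hyperbolic element: itself
    if it is diagonal, its product with [g j] if it is antidiagonal. *)
Lemma ev_elementary_pair (u z : 'cV[K]_2) : om u z != 0 ->
  (forall i, permutes_lines (g i) u z) ->
  eventually (fun n => elementary v (gen (gn n))).
Proof.
move=> uz guz; have u0 := om_ne0l uz; have z0 := om_ne0r uz.
have [gu|] := classic (forall i, collinear (g i *m u) u).
  exact: ev_elementary_line gu.
move/not_all_ex_not => [j nju].
case: (guz j) => [[gju _]|[[b gju] [b' gjz]]]; first by case: nju.
pose w := g j *m u.
have b0 : b != 0.
  apply: contraNneq u0 => b0.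
  by rewrite -[u](mulKmx (SL2_unit (g1 j))) gju b0 scale0r mulmx0.
have wE : w = b *: z by [].
have zE : z = b^-1 *: w by rewrite wE scalerA mulVf // scale1r.
have uw : om u w != 0.
  have -> : om u w = b * om u z by rewrite wE /om !mxE; ring.
  by rewrite mulf_neq0.
have Pu : colpair u w \in unitmx by rewrite colpair_unit.
set P := colpair u w in Pu; have [X gX] : exists X, forall i, g i *m P = P *m X i.
  by exists (fun i => invmx P *m (g i *m P)) => i; rewrite mulKVmx.
have XE i a b1 c d : g i *m u = a *: u + c *: w -> g i *m w = b1 *: u + d *: w ->
    X i = mx2 a b1 c d.
  move=> Eu Ew; apply: (can_inj (mulKmx Pu)).
  by rewrite -gX; apply: mul_colpair.
have Xmono i : monomial (X i).
  have [[[a Eu] [d Ez]]|[[c Eu] [d Ez]]] := guz i.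
    rewrite (@XE i a 0 0 d); first by left; rewrite !mx2E.
      by rewrite scale0r addr0.
    by rewrite scale0r add0r wE -scalemxAr Ez !scalerA mulrC.
  rewrite (@XE i 0 (b * d) (c / b) 0); first by right; rewrite !mx2E.
    by rewrite scale0r add0r Eu zE scalerA.
  by rewrite scale0r addr0 wE -scalemxAr Ez scalerA.
have Xdet i : \det (X i) = 1 by apply: conj_SL2_det Pu (g1 i) (gX i).
have [b1 [d1 gjw]] := om_basis (w := w) (g j *m w) uw.
have Xj : X j = mx2 0 (-1) 1 0.
  have Xj : X j = mx2 0 b1 1 d1 by apply: XE => //; rewrite scale0r add0r scale1r.
  have [[_]|[_]] := Xmono j; rewrite Xj mx2E.
    by move/eqP; rewrite oner_eq0.
  by move=> d10; have := Xdet j; rewrite Xj det_mx2 d10 mul0r sub0r mulr1 => /eqP;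
    rewrite eqr_oppLR => /eqP ->.
have [int|] := classic (forall i, mge 0 (X i)).
  by apply: ev_mono (ev_stab_vertex Pu _) => [n|i]; [left|rewrite -mulmxA gX mulKmx].
move/not_all_ex_not => [i nint].
have pair W a : a != 0 -> v a != 0 -> eval_word g W *m P = P *m mx2 a 0 0 a^-1 ->
    eventually (fun n => elementary v (gen (gn n))).
  move=> a0 va WP; apply: ev_mono (ev_stab_pair Pu a0 va WP _) => [n|i'].
    by right; right.
  by exists (X i').
have Xi := mx2_eta (X i); have := Xdet i.
have ne0 a d : a * d = 1 :> K -> a != 0 /\ d = a^-1.
  move=> ad; have a0 : a != 0.
    by apply/eqP => a0; move/eqP: ad; rewrite a0 mul0r eq_sym oner_eq0.
  by split=> //; apply: (mulfI a0); rewrite ad mulfV.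
case: (Xmono i) => [[X01 X10]|[X00 X11]]; rewrite det2.
  rewrite X01 mul0r subr0 => /ne0 [a0 dE].
  apply: (pair [:: (i, false)] (X i 0 0)) => //.
    apply/eqP => va; apply: nint; rewrite Xi X01 X10 dE.
    by apply: mge_mx2 => //; right; rewrite ?vV // va.
  by rewrite eval_letter /letter /= gX {1}Xi X01 X10 dE.
rewrite X00 mul0r sub0r -mulrN => /ne0 [a0 dE].
apply: (pair [:: (i, false); (j, false)] (X i 0 1)) => //.
  apply/eqP => va; apply: nint; rewrite Xi X00 X11.
  have -> : X i 1 0 = - (X i 0 1)^-1 by rewrite -dE opprK.
  by apply: mge_mx2 => //; [|apply: vgeN]; right; rewrite ?vV // va.
rewrite /= mulmx1 /letter /= -mulmxA gX mulmxA gX -mulmxA Xj; congr (_ *m _).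
by apply: mx2P; rewrite mulmx2 !mx2E ?X00 ?X11 -?dE; ring.
Qed.

End LimitElementary.

End Valuation.

Theorem theorem1p6 (K : fieldType) (v : K -> int) (r : nat)
  (gn : nat -> 'I_r -> 'M[K]_2) (g : 'I_r -> 'M[K]_2) :
  nonarch_local_field v ->
  (0 < r)%N ->
  (forall n i, SL2 (gn n i)) ->
  (forall n, discrete v (gen (gn n))) ->
  (forall n, ~ elementary v (gen (gn n))) ->
  (forall w : word r, exists h, mcvg v (fun n => eval_word (gn n) w) h) ->
  (forall i, mcvg v (fun n => gn n i) (g i)) ->
  (forall i, SL2 (g i)) ->
  [/\ discrete v (gen g), ~ elementary v (gen g) &
    exists n0 : nat, forall n, (n0 <= n)%N ->
      exists psi : 'M[K]_2 -> 'M[K]_2,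
        [/\ forall i, psi (g i) = gn n i,
            forall a b, gen g a -> gen g b -> psi (a *m b) = psi a *m psi b,
            forall a, gen g a -> gen (gn n) (psi a) &
            forall h, gen (gn n) h -> exists a, gen g a /\ psi a = h]].
Proof.
move=> Kv _ gn1 gnd gnne _ gncv g1.
have gn_g i : mlim v (fun n => gn n i) (g i) by apply: mcvg_mlim.
have [c cP] : exists c : nat, forall i, mge v (- c%:Z) (g i).
  exists (\max_i proj1_sig (constructive_indefinite_description _
    (mge_bound v (g i))))%N => i.
  set b := fun i => proj1_sig (constructive_indefinite_description _
    (mge_bound v (g i))).
  apply: mgeW (proj2_sig (constructive_indefinite_description _ (mge_bound v (g i)))).
  by have := leq_bigmax (F := b) i; rewrite /b; lia.
(* [c] bounds the limit generators, hence those of G_n for large n, so one [N] serves; the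
   alternative of a common invariant line is excluded because G_n fixes no end. *)
have [N NP] := uniformly_isolated Kv c.
have gn_iso : eventually (fun n => isolated1 v (gn n) N).
  apply: ev_mono (ev_fin (fun i => gn_g i 0)) => n near_g.
  have [i|//|[u [u0 gu]]] := NP r (gn n) (gn1 n) (gnd n).
    rewrite -[gn n i](subrK (g i)); apply: mgeD => //.
    by apply: mgeW (near_g i); lia.
  case: (gnne n); right; left; apply: (stab_end_of_line Kv _ u0) => // A hA.
  exact: SL2_unit (gen_SL2 (gn1 n) hA).
have gU A : gen g A -> A \in unitmx by move=> hA; apply: SL2_unit (gen_SL2 g1 hA).
split.
- exact: isolated1_discrete (limit_isolated1 Kv gn1 g1 gn_g gn_iso).
- move=> gel.
  suff /ev_exists [n /gnne] : eventually (fun n => elementary v (gen (gn n))) by [].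
  case: gel => [|[]].
  + move/(integral_of_stab_vertex Kv gU (gen_SL2 g1)) => [P Pu gP].
    apply: ev_mono (ev_stab_vertex Kv gn1 gn_g Pu _) => [n|i]; first by left.
    exact/gP/gen_gen.
  + move/(line_of_stab_end Kv gU) => [u u0 gu].
    apply: (ev_elementary_line Kv gn1 g1 gn_g gn_iso u0) => i.
    exact/gu/gen_gen.
  + move/(lines_of_stab_pair Kv gU) => [u [w [uw guw]]].
    apply: (ev_elementary_pair Kv gn1 g1 gn_g gn_iso uw) => i.
    exact/guw/gen_gen.
have [n0 n0P] := ev_homomorphism Kv gn1 g1 gn_g gn_iso.
exists n0 => n /n0P hom_n; exists (lift_gen gn g n); split.
- move=> i; rewrite -[RHS](eval_letter _ (i, false)); apply: hom_n.
  by rewrite eval_letter -wdP //; apply: gen_gen.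
- move=> A B hA hB; rewrite -eval_cat; apply: hom_n.
  by rewrite eval_cat -!wdP //; apply: gen_mul.
- by move=> A _; exists (wd g A).
- move=> _ [w ->]; exists (eval_word g w); split; first by exists w.
  by apply: hom_n; rewrite -wdP //; exists w.
Qed.
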